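(* Let $\mathcal{B}$ be a homothecy invariant collection of rectangular parallelepipeds in $\mathbb{R}^3$ whose sides are parallel to the coordinate axes and with sidelengths of the form $s, 2^j s, t$, where $s, t > 0$ and $j$ lies in a nonempty set $S \subset \mathbb{Z}$. If $S$ is a finite set, then the associated geometric maximal operator $M_{\mathcal{B}}$ satisfies a weak type estimate of the form $$\left|\left\{x \in \mathbb{R}^3 : M_{\mathcal{B}}f(x) > \alpha\right\}\right| \leq C \int_{\mathbb{R}^3} \frac{|f|}{\alpha}\left(1 + \log^+ \frac{|f|}{\alpha}\right)$$ but does not satisfy an estimate of the form $$\left|\left\{x \in \mathbb{R}^3 : M_{\mathcal{B}}f(x) > \alpha\right\}\right| \leq C \int_{\mathbb{R}^3} \phi\left(\frac{|f|}{\alpha}\right)$$ for any convex increasing function $\phi: [0, \infty) \rightarrow [0, \infty)$ satisfying the condition $$\lim_{x \rightarrow \infty}\frac{\phi(x)}{x (\log(1 + x))} = 0.$$ If $S$ is an infinite set, then the associated geometric maximal operator $M_{\mathcal{B}}$ satisfies a weak type estimate of the form $$\left|\left\{x \in \mathbb{R}^3 : M_{\mathcal{B}}f(x) > \alpha\right\}\right| \leq C \int_{\mathbb{R}^3} \frac{|f|}{\alpha} \left(1 + \log^+ \frac{|f|}{\alpha}\right)^{2}$$ but does not satisfy an estimate of the form $$\left|\left\{x \in \mathbb{R}^3 : M_{\mathcal{B}}f(x) > \alpha\right\}\right| \leq C \int_{\mathbb{R}^3} \phi\left(\frac{|f|}{\alpha}\right)$$ for any convex increasing function $\phi: [0, \infty)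 \rightarrow [0, \infty)$ satisfying the condition $$\lim_{x \rightarrow \infty}\frac{\phi(x)}{x (\log(1 + x))^2} = 0.$$
   Context: $|A|$ denotes the Lebesgue measure of a set $A \subset \mathbb{R}^3$, and integrals are with respect to Lebesgue measure. A collection $\mathcal{B}$ of sets is homothecy invariant if every translate of a dilate of a member of $\mathcal{B}$ again lies in $\mathcal{B}$. The geometric maximal operator associated with a collection $\mathcal{B}$ of sets in $\mathbb{R}^3$ is defined by $$M_{\mathcal{B}}f(x) = \sup_{x \in R \in \mathcal{B}} \frac{1}{|R|}\int_R |f|,$$ the supremum being over all $R \in \mathcal{B}$ containing $x$. Here $\log^+ u = \max(\log u, 0)$ for $u>0$ and $\log^+ 0 = 0$. Satisfying one of the displayed estimates means that it holds for all measurable functions $f$ on $\mathbb{R}^3$ and all $\alpha > 0$ with a finite constant $C$ independent of $f$ and $\alpha$.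
   Formalization: The functions φ are also required to satisfy φ(0) = 0 (if φ(0) > 0 the right side is always infinite and the estimate holds trivially), and the collection is taken to contain all (closed) parallelepipeds with sides s, 2^j s, t, j in S, since for subfamilies such as cubes the negative claim fails. *)

(* Defs.v *)
From HB Require Import structures.
From mathcomp Require Import all_boot all_order all_algebra.
From mathcomp Require Import all_classical all_reals all_analysis.
Import Order.TTheory GRing.Theory Num.Theory.
Import numFieldNormedType.Exports.
Set Implicit Arguments.
Unset Strict Implicit.
Unset Printing Implicit Defensive.
Local Open Scope classical_set_scope.
Local Open Scope ring_scope.

Local Notation borel_measure3 R :=
  ((@lebesgue_measure R \x @lebesgue_measure R) \x @lebesgue_measure R)%E.

(* R^3, carried by R * R * R, with the sigma-algebra of Lebesgue measurable
   sets, which is larger than the Borel one put on products by default. *)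
Definition lebesgue_space3 (R : realType) : measurableType _ :=
  caratheodory_type ((borel_measure3 R)^*)%mu.

Definition lebesgue_measure3 {R : realType} :
    set (lebesgue_space3 R) -> \bar R :=
  completed_measure_extension (mu := borel_measure3 R).

HB.instance Definition _ (R : realType) := Measure.on (@lebesgue_measure3 R).

Section maximal_operator.
Context {R : realType}.
Implicit Types (A : set (R * R * R)) (B : set (set (R * R * R))).

Definition homothecy_invariant B : Prop :=
  forall A (r : R) (v : R * R * R),
    B A -> 0 < r -> B [set v + r *: p | p in A].

(* Closed, with side lengths a, b, c along the three axes in this order. *)
Definition is_parallelepiped (a b c : R) A : Prop :=
  exists x y z : R,
    A = (`[x, x + a] `*` `[y, y + b]) `*` `[z, z + c].

(* Every shape (s, 2^j s, t) with j in S occurs in B; with homothecy invariance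
   B is then the collection of all parallelepipeds of these shapes. Inclusion
   alone would not do: if 0 \in S, the cubes form a homothecy invariant
   subfamily, whose maximal operator is of weak type (1, 1). *)
Definition dyadic_zygmund_collection (S : set int) B : Prop :=
  [/\ homothecy_invariant B,
      (forall A, B A -> exists (s t : R) (j : int),
         [/\ 0 < s, 0 < t, S j & is_parallelepiped s (2 ^ j * s) t A]) &
      (forall (s t : R) (j : int), 0 < s -> 0 < t -> S j ->
         exists2 A, B A & is_parallelepiped s (2 ^ j * s) t A)].

Definition geometric_maximal B (f : R * R * R -> R) (x : R * R * R) : \bar R :=
  ereal_sup [set ((lebesgue_measure3 A)^-1 *
                   \int[lebesgue_measure3]_(y in A) `|f y|%:E)%E
            | A in [set A | B A /\ A x]].

Definition weak_type_estimate B (Phi : R -> R) : Prop :=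
  exists C : R, forall (f : lebesgue_space3 R -> R) (alpha : R),
    measurable_fun [set: lebesgue_space3 R] f -> 0 < alpha ->
    (lebesgue_measure3 [set x | alpha%:E < geometric_maximal B f x] <=
     C%:E * \int[lebesgue_measure3]_x (Phi (`|f x| / alpha))%:E)%E.

(* ln 0 = 0 in the library, so that logp 0 = 0. *)
Definition logp (u : R) : R := Num.max (ln u) 0.

(* phi is given on the whole of R but only its restriction to [0, +oo[ is
   constrained. The condition phi 0 = 0 is the usual normalization of Young
   functions; if phi 0 > 0, then phi (|f| / alpha) has infinite integral for
   every f and the weak type estimate holds trivially. *)
Definition convex_increasing (phi : R -> R) : Prop :=
  [/\ forall x, 0 <= x -> 0 <= phi x,
      @convex_function R R^o `[0, +oo[ phi,
      {in `[0, +oo[ &, {homo phi : x y / x <= y}} &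
      phi 0 = 0].

End maximal_operator.

(* Main.v *)
Require Import Defs.
From mathcomp Require Import all_boot all_order all_algebra.
From mathcomp Require Import all_classical all_reals all_analysis.
From mathcomp Require Import measurable_realfun.
From mathcomp Require Import zify ring lra.
Import Order.TTheory GRing.Theory Num.Theory.
Import numFieldNormedType.Exports.
Local Open Scope classical_set_scope.
Local Open Scope ring_scope.

(** Upper estimates. A box is contained in a box of grid cells of comparable size,
so that the maximal operator is dominated, when the mesh tends to zero, by
maximal operators over boxes of indices in a finite grid, applied to the
averages of |f| over the cells. On a finite grid there is no question of
measurability, and the argument of Jessen, Marcinkiewicz and Zygmund becomes
finite combinatorics. Vitali's covering argument gives the weak type (1,1) for
intervals, and also for plane rectangles whose sides have a bounded ratio
([weak_LlogL_engulfing]). If boxes A have an estimate with the growth u (log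
u)^k and boxes B have weak type (1,1), then the boxes A x B have an estimate
with the growth u (log u)^(k+1) ([weak_LlogL_prod]). Arbitrary boxes are
products of three intervals, which gives the exponent 2. When S is finite, the
sides s and 2^j s have a bounded ratio and the boxes are products of a fat
rectangle and an interval, which gives the exponent 1. The estimates are
uniform in the grid; [average_LlogL_le] returns from the averages of f to f,
and [weak_type_of_grid] carries out the limit.

Lower estimates. It is enough to find, for each m, a set E such that the
maximal function of its indicator exceeds 4^-(m+1) on a set of measure at
least a constant times m^k 4^m |E| ([no_estimate_of_large_superlevels]). For k
= 1 one shape is enough: E is a box of this shape, and the superlevel set
contains a fixed part of each of the m boxes that arise from E when the
horizontal sides are multiplied by 2^a and the vertical one by 2^(2(m-a)+1),
for a = 1, ..., m.

For k = 2 there must be m^2 pieces, one for each pair of horizontal dilations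
(2^a, 2^b). A box E will not do: only the pairs with b - a in S would be
available, and S may be as sparse as one likes. One side of E is therefore
replaced by a Cantor set X_0, the smallest of sets X_a obtained by requiring
that some prescribed binary digits vanish and then giving up the last a
requirements. Around each point of X_a the density of X_0 is 2^-a at every
scale between the last digit kept and the first digit given up. Spreading out
the digits makes this range of scales so long that it contains a scale
compatible with the length 2^b of the other side and an element of S, for each
b ([cantor_sets]). If S is bounded above, it is unbounded below, and the two
horizontal coordinates exchange their roles. *)

Set Implicit Arguments.
Unset Strict Implicit.
Unset Printing Implicit Defensive.

(** * Maximal operators on finite sets *)

Section finite_maximal.
Context {R : realType}.
Implicit Types (T : finType).

(** The union of the members that a greedy choice of Q makes superfluous:
those that meet Q and have at most as many points. *)
Definition star T (F : {set {set T}}) (Q : {set T}) : {set T} :=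
  \bigcup_(P in F | (#|P| <= #|Q|)%N && ~~ [disjoint P & Q]%B) P.

(** The doubling property behind Vitali's argument, in terms of cardinals
only, so that it also makes sense at the edges of a finite grid. *)
Definition engulfing T (C : nat) (F : {set {set T}}) :=
  forall Q, Q \in F -> (#|star F Q| <= C * #|Q|)%N.

Lemma engulfingS T C (F G : {set {set T}}) :
  G \subset F -> engulfing C F -> engulfing C G.
Proof.
move=> /fintype.subsetP GF eF Q /GF /eF; apply: leq_trans.
apply: subset_leq_card; apply/bigcupsP => P /andP[PG h]; rewrite /star.
by apply: (bigcup_max P) => //; rewrite GF.
Qed.

(** A member Q of maximal cardinal is selected, and the members that meet it
are discarded: they lie in the star of Q, whose cardinal is at most C
times that of Q. The remaining members are disjoint from Q, so that the
sums of f over the selected sets add up. *)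
Lemma vitali_covering T C (F : {set {set T}}) (f : T -> R) lam :
  (forall x, 0 <= f x) -> 0 <= lam -> engulfing C F ->
  (forall Q, Q \in F -> lam * #|Q|%:R <= \sum_(x in Q) f x) ->
  lam * #|finset.cover F|%:R <= C%:R * \sum_(x in finset.cover F) f x.
Proof.
move=> f0 lam0; have [N] := ubnP #|F|; elim: N F => // N IH F FN eF FF.
have [->|[Q0 Q0F]] := set_0Vmem F.
  by rewrite /finset.cover big_set0 cards0 mulr0 big_set0 mulr0.
pose Q := [arg max_(Q > Q0 in F) #|Q|]%N.
have [QF Qmax] : Q \in F /\ forall P, P \in F -> (#|P| <= #|Q|)%N.
  by rewrite /Q; case: arg_maxnP.
have [Q00|Qn0] := eqVneq Q finset.set0.
  have cF : finset.cover F = finset.set0.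
    apply/eqP; rewrite -finset.subset0; apply/bigcupsP => P PF.
    by have := Qmax _ PF; rewrite Q00 cards0 leqn0 cards_eq0 => /eqP ->.
  by rewrite cF cards0 mulr0 big_set0 mulr0.
pose G : {set {set T}} := [set P in F | [disjoint P & Q]%B]%SET.
have GF : G \subset F by apply/fintype.subsetP => P; rewrite inE => /andP[].
have QG : Q \notin G.
  by rewrite inE QF /= -setI_eq0 finset.setIid.
have /IH IHG : (#|G| < N)%N.
  rewrite -ltnS; apply: leq_trans FN; rewrite ltnS; apply: proper_card.
  by apply/properP; split => //; exists Q.
have {}IHG := IHG (engulfingS GF eF) (fun P PG =>
  FF P (fintype.subsetP GF P PG)).
have cov : finset.cover F \subset (star F Q :|: finset.cover G)%SET.
  apply/bigcupsP => P PF; have [dPQ|dPQ] := boolP [disjoint P & Q]%B.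
    apply: fintype.subset_trans (finset.subsetUr _ _).
    by apply: (bigcup_max P) => //; rewrite inE PF.
  apply: fintype.subset_trans (finset.subsetUl _ _).
  by apply: (bigcup_max P) => //; rewrite PF Qmax.
have dQG : [disjoint Q & finset.cover G]%B.
  apply: finset.bigcup_disjoint => P.
  by rewrite inE disjoint_sym => /andP[].
have sub2 : (Q :|: finset.cover G)%SET \subset finset.cover F.
  rewrite finset.subUset (bigcup_max Q)//=; apply/bigcupsP => P PG.
  by apply: (bigcup_max P) => //; apply: (fintype.subsetP GF).
have c1 : (#|finset.cover F| <= C * #|Q| + #|finset.cover G|)%N.
  apply: (leq_trans (subset_leq_card cov)).
  apply: (leq_trans (leq_card_setU _ _)).
  by rewrite leq_add2r; apply: eF.
apply: (@le_trans _ _ (lam * (C%:R * #|Q|%:R + #|finset.cover G|%:R))).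
  by rewrite ler_wpM2l// -natrM -natrD ler_nat.
apply: (@le_trans _ _ (C%:R * (\sum_(x in (Q :|: finset.cover G)%SET) f x)));
  last first.
  rewrite ler_wpM2l// [leRHS](big_setID (Q :|: finset.cover G)%SET)/=.
  by rewrite (finset.setIidPr sub2) lerDl sumr_ge0.
have -> : \sum_(x in (Q :|: finset.cover G)%SET) f x =
    \sum_(x in Q) f x + \sum_(x in finset.cover G) f x.
  by rewrite -bigU//=; apply: eq_bigl => x; rewrite inE.
rewrite mulrDr mulrDr lerD// mulrCA ler_wpM2l//.
exact: FF.
Qed.

Definition maxop T (F : {set {set T}}) (f : T -> R) (x : T) : R :=
  \big[Num.max/0]_(Q in F | x \in Q) ((\sum_(y in Q) f y) / #|Q|%:R).

Lemma maxop_ge0 T (F : {set {set T}}) f x : 0 <= maxop F f x.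
Proof. exact: bigmax_ge_id. Qed.

Lemma le_maxop T (F : {set {set T}}) f x (Q : {set T}) : Q \in F -> x \in Q ->
  (\sum_(y in Q) f y) / #|Q|%:R <= maxop F f x.
Proof. by move=> QF xQ; apply: le_bigmax_cond; rewrite QF. Qed.

Lemma maxop_gtP T (F : {set {set T}}) f x t : 0 <= t ->
  reflect (exists2 Q : {set T}, Q \in F /\ x \in Q &
             t * #|Q|%:R < \sum_(y in Q) f y)
    (t < maxop F f x).
Proof.
move=> t0; apply: (iffP idP).
  move=> /bigmax_gtP[|[Q /andP[QF xQ]]]; first by rewrite ltNge t0.
  rewrite ltr_pdivlMr; first by exists Q.
  by rewrite ltr0n; apply/card_gt0P; exists x.
move=> [Q [QF xQ] h]; apply: (lt_le_trans _ (le_maxop _ QF xQ)).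
by rewrite ltr_pdivlMr// ltr0n; apply/card_gt0P; exists x.
Qed.

Lemma maxopZ T (F : {set {set T}}) f x c t : 0 < c -> 0 <= t ->
  (c * t < maxop F (fun y => c * f y) x) = (t < maxop F f x).
Proof.
move=> c0 t0; apply/maxop_gtP/maxop_gtP => //; first by rewrite mulr_ge0// ltW.
- by move=> [Q QF]; rewrite -mulr_sumr -mulrA ltr_pM2l//; exists Q.
- by move=> [Q QF]; exists Q => //; rewrite -mulr_sumr -mulrA ltr_pM2l.
Qed.

Lemma ex_pow2_ge (v : R) : exists n, v <= 2 ^+ n.
Proof. by exists (Num.bound v); apply: ltW; apply: upper_nthrootP. Qed.

(** The level sets of a maximal function are counted along the levels 1, 2, 4,
..., and this discrete logarithm makes the count exact: it is the number
of these levels that v exceeds. *)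
Definition log2up (v : R) : nat := ex_minn (ex_pow2_ge v).

Lemma ltn_log2up n v : (n < log2up v)%N = (2 ^+ n < v).
Proof.
rewrite /log2up; case: ex_minnP => m vm mmin; apply/idP/idP => h.
  by rewrite ltNge; apply/negP => /mmin; rewrite leqNgt h.
rewrite ltnNge; apply/negP => mn; move: h; rewrite ltNge => /negP; apply.
by rewrite (le_trans vm)// ler_weXn2l// ler1n.
Qed.

Lemma log2up_gt0 v : (0 < log2up v)%N = (1 < v).
Proof. by rewrite ltn_log2up expr0. Qed.

(** The factor that tests the positivity of the logarithm only matters for k =
0: it makes the function vanish for v at most 1, where it must, because
small values of f do not contribute to a superlevel set. *)
Definition LlogL k (v : R) : R := v * (log2up v ^ k * (0 < log2up v))%:R.

(** Level 1 is enough, by homogeneity. The dilation c of the argument absorbs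
the constants that are lost at each truncation. *)
Definition weak_LlogL T k (C c : R) (F : {set {set T}}) :=
  forall f : T -> R, (forall x, 0 <= f x) ->
    #|[set x | (1 : R) < maxop F f x]%SET|%:R <= C * \sum_x LlogL k (c * f x).

(** Values of f below 1/2 raise the averages by at most 1/2. Hence only the
part g of f above 1/2 matters, at level 1/2. *)
Lemma weak_LlogL_engulfing T C (F : {set {set T}}) :
  engulfing C F -> weak_LlogL 0 C%:R 2 F.
Proof.
move=> eF f f0.
pose g x := if 1 < 2 * f x then f x else 0.
have g0 x : 0 <= g x by rewrite /g; case: ifP.
pose G : {set {set T}} := [set Q in F | (2^-1 * #|Q|%:R : R) <= \sum_(x in Q) g x]%SET.
have := @vitali_covering T C G g 2^-1 g0.
rewrite invr_ge0 ler0n => /(_ isT) h.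
have {h}h : 2^-1 * #|finset.cover G|%:R <= C%:R * \sum_(x in finset.cover G) g x.
  apply: h; last by move=> Q; rewrite inE => /andP[].
  by apply: engulfingS eF; apply/fintype.subsetP => Q; rewrite inE => /andP[].
have sG : [set x | (1:R) < maxop F f x]%SET \subset finset.cover G.
  apply/fintype.subsetP => x; rewrite inE => /maxop_gtP[//|Q [QF xQ] hQ].
  apply/bigcupP; exists Q => //; rewrite inE QF/=.
  have : \sum_(y in Q) f y <= \sum_(y in Q) (g y + 2^-1).
    apply: ler_sum => y _; rewrite /g; case: ltP => hy; first by rewrite lerDl.
    by rewrite add0r; lra.
  rewrite big_split/= sumr_const -mulr_natl; lra.
apply: (@le_trans _ _ #|finset.cover G|%:R).
  by rewrite ler_nat subset_leq_card.
rewrite -(ler_pM2l (_ : 0 < 2^-1 :> R))//; apply: (le_trans h).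
rewrite mulrCA ler_wpM2l//.
apply: (@le_trans _ _ (\sum_x g x)).
  by rewrite [leRHS](bigID (mem (finset.cover G)))/= lerDl sumr_ge0.
rewrite mulr_sumr; apply: ler_sum => x _;
  rewrite /LlogL /g log2up_gt0 expn0 mul1n.
by case: ifP => _; rewrite ?mulr0 ?mulr0// mulr1 mulKf.
Qed.

Definition box_family (T1 T2 : finType) (F : {set {set T1}}) (G : {set {set T2}}) :
  {set {set T1 * T2}} := [set finset.setX A B | A in F, B in G]%SET.

(** The last term of the sum already bounds the left-hand side. *)
Lemma LlogL_le_levels k v N : (log2up v <= N)%N ->
  LlogL k v <= \sum_(n < N | 2 ^+ n < v) 2 ^+ n.+1 * (n.+1 ^ k)%:R.
Proof.
move=> vN; rewrite /LlogL; case E : (log2up v) => [|m].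
  by rewrite muln0 mulr0 sumr_ge0// => n _; rewrite mulr_ge0// exprn_ge0.
have mN : (m < N)%N by rewrite -E.
rewrite (bigD1 (Ordinal mN))/=; last by rewrite -ltn_log2up E.
rewrite muln1 ler_wpDr//.
  by apply: sumr_ge0 => n _; rewrite mulr_ge0// exprn_ge0.
by rewrite ler_wpM2r// leNgt -ltn_log2up E ltnn.
Qed.

(** The average over A x B is an average over A of averages over B, so it is
bounded by the maximal function on the first factor of h, the maximal
function on the second factor of f. The estimate for the first factor
bounds the superlevel set of f by a sum of LlogL k at h. Splitting this
sum along the levels 2^n of h, the weak type (1,1) on the second factor
gives at each level a sum of f over the points where f exceeds a multiple
of 2^n. Each point is counted at about log f levels with a weight (n+1)^k,
and one more logarithm appears. *)
Lemma weak_LlogL_prod (T1 T2 : finType) k C c C' c' (F : {set {set T1}})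
    (G : {set {set T2}}) : 0 <= C -> 0 < c -> 0 <= C' -> 0 < c' ->
  weak_LlogL k C c F -> weak_LlogL 0 C' c' G ->
  weak_LlogL k.+1 (2 * C * C') (c' * c) (box_family F G).
Proof.
move=> C0 c0 C'0 c'0 wF wG f f0.
pose h y x := maxop G (fun y' => f (x, y')) y.
have h0 y x : 0 <= h y x by exact: maxop_ge0.
pose v p := c' * c * f p.
(* Beyond N no level is exceeded, so all sums over levels share one range. *)
pose N := (\max_(p : T1 * T2) log2up (c * h p.2 p.1))%N.
apply: (@le_trans _ _ (\sum_y C * \sum_x LlogL k (c * h y x))).
  apply: (@le_trans _ _ (\sum_y #|[set x | (1:R) < maxop F (h y) x]%SET|%:R));
    last first.
    by apply: ler_sum => y _; apply: wF.
  rewrite -natr_sum ler_nat.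
  rewrite [leqRHS](_ : _ = #|[set p | (1:R) < maxop F (h p.2) p.1]%SET|);
    last first.
    rewrite -sum1dep_card/= (eq_bigr (fun y =>
      (\sum_(x | (1 < maxop F (h y) x)%R) 1)%N)).
      by rewrite (exchange_big_dep predT)//= pair_big_dep/=.
    by move=> y _; rewrite -sum1dep_card.
  apply: subset_leq_card; apply/fintype.subsetP => -[x y]; rewrite !inE/=.
  move=> /maxop_gtP[//|_ [/imset2P[A B AF BG ->]]].
  rewrite inE/= => /andP[xA yB]; rewrite cardsX => hAB.
  have B0 : (0 < #|B|%:R :> R) by rewrite ltr0n; apply/card_gt0P; exists y.
  apply/maxop_gtP => //; exists A => //; rewrite mul1r.
  apply: (@lt_le_trans _ _ (\sum_(x' in A) (\sum_(y' in B) f (x', y')) / #|B|%:R)).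
    rewrite -mulr_suml ltr_pdivlMr// -natrM pair_big_dep/=.
    move: hAB; rewrite mul1r => /lt_le_trans; apply.
    rewrite le_eqVlt; apply/orP; left; apply/eqP.
    apply: eq_big => [[a b]|[a b] _] //=; by rewrite inE.
  apply: ler_sum => x' _; exact: le_maxop.
rewrite -mulr_sumr -mulrA mulrCA -mulrA ler_wpM2l//.
apply: (@le_trans _ _ (\sum_y \sum_x \sum_(n < N | 2 ^+ n < c * h y x)
    2 ^+ n.+1 * (n.+1 ^ k)%:R)).
  apply: ler_sum => y _; apply: ler_sum => x _; apply: LlogL_le_levels.
  exact: (@leq_bigmax _ (fun p : T1 * T2 => log2up (c * h p.2 p.1)) (x, y)).
apply: (@le_trans _ _ (\sum_(n < N) 2 ^+ n.+1 * (n.+1 ^ k)%:R *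
    (\sum_x #|[set y | (2 ^+ n : R) < c * h y x]%SET|%:R))).
  rewrite le_eqVlt; apply/orP; left; apply/eqP.
  rewrite exchange_big/=.
  under eq_bigr do rewrite (exchange_big_dep predT)//=.
  rewrite exchange_big/=; apply: eq_bigr => n _.
  rewrite mulr_sumr; apply: eq_bigr => x _.
  rewrite sumr_const -[LHS]mulr_natr; congr (_ * _%:R).
  by apply: eq_card => y; rewrite !inE.
apply: (@le_trans _ _ (\sum_(n < N) 2 ^+ n.+1 * (n.+1 ^ k)%:R *
    (\sum_x C' * \sum_y (if 2 ^+ n < v (x, y) then v (x, y) / 2 ^+ n else 0)))).
  apply: ler_sum => n _; rewrite ler_wpM2l ?mulr_ge0 ?exprn_ge0//.
  apply: ler_sum => x _.
  have p2 : 0 < 2 ^+ n :> R by rewrite exprn_gt0.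
  have cn : 0 < c / 2 ^+ n by rewrite divr_gt0.
  have := wG (fun y => c / 2 ^+ n * f (x, y)).
  have -> : [set y | 1 < maxop G (fun y0 => c / 2 ^+ n * f (x, y0)) y]%SET =
      [set y | 2 ^+ n < c * h y x]%SET.
    apply/setP => y; rewrite !inE.
    rewrite [X in X < maxop _ _ _](_ : _ = c / 2 ^+ n * (2 ^+ n / c));
      last first.
      by rewrite mulrA divfK ?gt_eqF// divff// gt_eqF.
    rewrite maxopZ//; last by rewrite divr_ge0// ltW.
    by rewrite ltr_pdivrMr// mulrC.
  move=> /(_ (fun y => mulr_ge0 (ltW cn) (f0 _))) /le_trans; apply.
  rewrite ler_wpM2l//; apply: ler_sum => y _.
  rewrite /LlogL expn0 mul1n log2up_gt0.
  have -> : c' * (c / 2 ^+ n * f (x, y)) = v (x, y) / 2 ^+ n.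
    by rewrite /v !mulrA mulrAC.
  by rewrite ltr_pdivlMr// mul1r; case: ifP; rewrite ?mulr1 ?mulr0.
have vge0 p : 0 <= v p by rewrite /v mulr_ge0// mulr_ge0// ltW.
apply: (@le_trans _ _ (\sum_x \sum_y \sum_(n < N | 2 ^+ n < v (x, y))
   C' * 2 * v (x, y) * (n.+1 ^ k)%:R)).
  rewrite le_eqVlt; apply/orP; left; apply/eqP.
  under [RHS]eq_bigr do rewrite (exchange_big_dep predT)//=.
  rewrite exchange_big/=; apply: eq_bigr => n _.
  rewrite mulr_sumr; apply: eq_bigr => x _.
  rewrite !mulr_sumr [RHS]big_mkcond/=; apply: eq_bigr => y _.
  case: ifP; rewrite ?mulr0// => _; rewrite exprS.
  have p2 : 2 ^+ n != 0 :> R by rewrite gt_eqF// exprn_gt0.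
  by field.
rewrite pair_big/= mulr_sumr; apply: ler_sum => -[x y] _ /=.
rewrite -mulr_sumr /LlogL -/(v (x, y)) (mulrC 2) [leRHS]mulrA ler_wpM2l//.
  by rewrite mulr_ge0// mulr_ge0.
rewrite -natr_sum ler_nat.
set L := log2up _.
rewrite (eq_bigl (fun n : 'I_N => n < L)%N); last by move=> n;
  rewrite ltn_log2up.
apply: (@leq_trans (\sum_(n < N | (n < L)%N) 1 * L ^ k)%N).
  apply: leq_sum => n nL; rewrite mul1n; case: (k) => // k'.
  by rewrite leq_exp2r.
rewrite -big_distrl/= => //.
have -> : (\sum_(n < N | n < L) 1 = minn N L)%N.
  elim: (N) => [|m IH]; first by rewrite big_ord0 min0n.
  rewrite big_mkcond big_ord_recr -big_mkcond/= IH.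
  by case: ltnP; lia.
have [->|L0] := posnP L; first by rewrite minn0.
by rewrite muln1 expnS leq_mul2r geq_minr orbT.
Qed.

End finite_maximal.

(** * Intervals and boxes of indices *)

Section index_boxes.
Context {R : realType}.

Definition index_itv n (l m : nat) : {set 'I_n} := [set i : 'I_n | (l <= i <= m)%N]%SET.

Definition index_itvs n : {set {set 'I_n}} :=
  [set Q | [exists l : 'I_n, exists m : 'I_n, (l <= m)%N && (Q == index_itv n l m)]]%SET.

Lemma card_ord_itv n (a b : nat) :
  (#|[set i : 'I_n | (a <= i < b)%N]%SET| <= b - a)%N.
Proof.
elim: b => [|b IH].
  by rewrite (eq_card0 (A := _)) ?sub0n// => i; rewrite !inE ltn0 andbF.
have [ab|ba] := leqP a b; last first.
  rewrite (eq_card0 (A := _)) // => i; rewrite !inE; lia.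
rewrite subSn//; have [bn|nb] := ltnP b n.
  apply: (@leq_trans #|(Ordinal bn |: [set i : 'I_n | (a <= i < b)%N])%SET|).
    apply: subset_leq_card; apply/fintype.subsetP => i; rewrite !inE -val_eqE/=.
    by move=> /andP[-> ]; rewrite ltnS leq_eqVlt.
  by rewrite cardsU1 -add1n leq_add // leq_b1.
apply: leqW; apply: leq_trans IH; apply: subset_leq_card;
  apply/fintype.subsetP => i.
by rewrite !inE => /andP[-> _]; rewrite (leq_trans (ltn_ord i)).
Qed.

Lemma card_index_itv n l m : (l <= m < n)%N -> #|index_itv n l m| = (m - l).+1.
Proof.
move=> /andP[lm mn]; have h (k : 'I_(m - l).+1) : (l + k < n)%N.
  by have := ltn_ord k; lia.
pose g (k : 'I_(m - l).+1) := Ordinal (h k).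
have gi : injective g by move=> a b /(congr1 val)/= /addnI ab; apply: val_inj.
rewrite -[RHS](card_ord (m - l).+1) -(card_codom gi); apply: eq_card => i.
rewrite inE; apply/idP/codomP => [/andP[li im]|[k ->]]/=.
  have ik : (i - l < (m - l).+1)%N by lia.
  by exists (Ordinal ik); apply: val_inj => /=; rewrite subnKC.
by have := ltn_ord k; lia.
Qed.

Lemma mem_index_itvs n l m : (l <= m < n)%N -> index_itv n l m \in index_itvs n.
Proof.
move=> /andP[lm mn]; rewrite inE; apply/existsP;
  exists (Ordinal (leq_ltn_trans lm mn)).
by apply/existsP; exists (Ordinal mn); rewrite /= lm eqxx.
Qed.

(** The enlarged interval has D times the length of Q added on both sides. *)
Lemma index_itvs_enlarge n D (Q : {set 'I_n}) : Q \in index_itvs n ->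
  exists2 Q' : {set 'I_n}, (#|Q'| <= D.*2.+1 * #|Q|)%N &
    forall P : {set 'I_n}, P \in index_itvs n -> (#|P| <= D * #|Q|)%N ->
      ~~ [disjoint P & Q]%B -> P \subset Q'.
Proof.
rewrite inE => /existsP[l /existsP[m /andP[lm /eqP ->]]].
have cQ : #|index_itv n l m| = (m - l).+1 by rewrite card_index_itv// lm/=.
pose q := (D * (m - l).+1)%N.
exists [set i : 'I_n | (l - q <= i < m + q.+1)%N]%SET.
  apply: (leq_trans (card_ord_itv _ _ _)); rewrite cQ /q; lia.
move=> P; rewrite inE => /existsP[a /existsP[b /andP[ab /eqP ->]]].
rewrite card_index_itv; last by rewrite ab/=.
rewrite cQ -/q => cP /pred0Pn[i]/=; rewrite !inE => hi.
by apply/fintype.subsetP => j; rewrite !inE; lia.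
Qed.

Lemma engulfing_index_itvs n : engulfing 3 (index_itvs n).
Proof.
move=> Q /(@index_itvs_enlarge n 1)[Q' cQ' h]; apply: leq_trans cQ'.
apply: subset_leq_card; apply/bigcupsP => P /and3P[PF cP dP].
by apply: h; rewrite // mul1n.
Qed.

(** Rectangles with sides of ratio at most D rather than squares: the traces
on the grid of boxes of a fixed shape are not exactly similar. *)
Definition fat_rects D n : {set {set 'I_n * 'I_n}} :=
  [set Q | [exists A in index_itvs n, exists B in index_itvs n,
    [&& (#|A| <= D * #|B|)%N, (#|B| <= D * #|A|)%N & Q == finset.setX A B]]]%SET.

Lemma fat_rectsP D n Q : reflect (exists A B : {set 'I_n},
   [/\ A \in index_itvs n, B \in index_itvs n, (#|A| <= D * #|B|)%N, (#|B| <= D * #|A|)%N &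
     Q = finset.setX A B]) (Q \in fat_rects D n).
Proof.
rewrite inE; apply: (iffP existsP).
  move=> [A /andP[AF /existsP[B /andP[BF /and3P[h1 h2 /eqP h]]]]].
  by exists A, B; split.
move=> [A [B [AF BF h1 h2 ->]]]; exists A; rewrite AF; apply/existsP; exists B.
by rewrite BF h1 h2 eqxx.
Qed.

(** If a fat rectangle has at most as many points as another one, then each of
its sides is at most D times the corresponding side of the other. *)
Lemma engulfing_fat_rects D n : engulfing (D.*2.+1 * D.*2.+1) (fat_rects D n).
Proof.
move=> Q /fat_rectsP[A [B [AF BF AB BA ->]]].
have [A' cA hA] := @index_itvs_enlarge n D A AF;
  have [B' cB hB] := @index_itvs_enlarge n D B BF.
apply: (@leq_trans #|finset.setX A' B'|); last first.
  by rewrite !cardsX mulnACA leq_mul.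
apply: subset_leq_card; apply/bigcupsP =>
  P /and3P[/fat_rectsP[A1 [B1 [A1F B1F AB1 BA1 ->]]]].
rewrite !cardsX => cP dP.
have [d1 d2] : ~~ [disjoint A1 & A]%B /\ ~~ [disjoint B1 & B]%B.
  move: dP => /pred0Pn[[x y]]/=; rewrite !inE/= =>
    /andP[/andP[x1 y1] /andP[x2 y2]].
  by split; apply/pred0Pn; [exists x; rewrite /= x1 | exists y; rewrite /= y1].
apply/fintype.subsetP => -[x y]; rewrite !inE/= => /andP[xA1 yB1].
(* a1^2 <= D a1 b1 <= D a b <= (D a)^2 *)
have bound a b a1 b1 : (a1 <= D * b1 -> b <= D * a -> a1 * b1 <= a * b -> a1 <= D * a)%N.
  move=> h1 h2 h3; rewrite -leq_sqr -!mulnn.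
  apply: (@leq_trans (D * (a1 * b1))%N);
    first by rewrite mulnCA leq_mul2l h1 orbT.
  apply: (@leq_trans (D * (a * b))%N); first by rewrite leq_mul2l h3 orbT.
  by rewrite -mulnA leq_mul2l (leq_mul (leqnn a) h2) orbT.
have cA1 := bound _ _ _ _ AB1 BA cP.
have cB1 : (#|B1| <= D * #|B|)%N by apply: (bound _ _ _ _ BA1 AB);
  rewrite mulnC (mulnC #|B|).
rewrite (fintype.subsetP (hA _ A1F cA1 d1))//=.
exact: (fintype.subsetP (hB _ B1F cB1 d2)).
Qed.

Lemma weak_LlogL_boxes : exists C c : R, [/\ 0 < C, 0 < c & forall n,
  weak_LlogL 2 C c (box_family (box_family (index_itvs n) (index_itvs n)) (index_itvs n))].
Proof.
have w n := weak_LlogL_engulfing (R := R) (@engulfing_index_itvs n).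
exists (2 * (2 * 3%:R * 3%:R) * 3%:R), (2 * (2 * 2)); split => // n.
by apply: weak_LlogL_prod => //; rewrite ?mulr_ge0 ?mulr_gt0//;
  apply: weak_LlogL_prod.
Qed.

Lemma weak_LlogL_fat_boxes D : exists C c : R, [/\ 0 < C, 0 < c & forall n,
  weak_LlogL 1 C c (box_family (fat_rects D n) (index_itvs n))].
Proof.
have w n := weak_LlogL_engulfing (R := R) (@engulfing_index_itvs n).
exists (2 * (D.*2.+1 * D.*2.+1)%:R * 3%:R), (2 * 2); split => [||n].
- by rewrite !mulr_gt0// ltr0n muln_gt0.
- by rewrite !mulr_gt0.
- apply: weak_LlogL_prod => //; exact/weak_LlogL_engulfing/engulfing_fat_rects.
Qed.

End index_boxes.

(** * Lebesgue measure on three-dimensional space *)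

Section lebesgue_space3_theory.
Context {R : realType}.
Local Notation mu1 := (@lebesgue_measure R).
Local Notation mu3 := (@lebesgue_measure3 R).

Lemma measurable_borel3 (A : set (R * R * R)) :
  measurable A -> measurable (A : set (lebesgue_space3 R)).
Proof. by move=> mA; apply: sub_caratheodory; exact: sub_sigma_algebra. Qed.

Lemma measurable_box3 (A B C : set R) : measurable A -> measurable B -> measurable C ->
  measurable ((A `*` B) `*` C : set (lebesgue_space3 R)).
Proof.
move=> mA mB mC; apply: measurable_borel3.
by apply: measurableX => //; apply: measurableX.
Qed.

Lemma lebesgue_measure3_box (A B C : set R) : measurable A -> measurable B -> measurable C ->
  mu3 ((A `*` B) `*` C) = (mu1 A * mu1 B * mu1 C)%E.
Proof.
move=> mA mB mC; have mA' : measurable (A : set (measurableTypeR R)) by [].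
have mB' : measurable (B : set (measurableTypeR R)) by [].
have mC' : measurable (C : set (measurableTypeR R)) by [].
rewrite -(product_measure1E mu1 mu1 mA' mB').
rewrite -(product_measure1E (mu1 \x mu1)%E mu1 (measurableX mA' mB') mC').
by apply: measurable_mu_extE; apply: measurableX => //; exact: measurableX.
Qed.

Lemma le_lebesgue_measure3 (A B : set (R * R * R)) : A `<=` B -> (mu3 A <= mu3 B)%E.
Proof.
move=> AB; rewrite /lebesgue_measure3 /completed_measure_extension.
exact: (@le_mu_ext _ _ _ ((mu1 \x mu1) \x mu1)%E _ _ AB).
Qed.

Lemma lebesgue_measure_cc (a b : R) : a <= b -> mu1 `[a, b] = (b - a)%:E.
Proof.
move=> ab; rewrite lebesgue_measure_itv/= lte_fin; case: ltP => // ba.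
by rewrite (le_anti (introT andP (conj ab ba))) subrr.
Qed.

Lemma lebesgue_measure_co (a b : R) : a <= b -> mu1 `[a, b[ = (b - a)%:E.
Proof.
move=> ab; rewrite lebesgue_measure_itv/= lte_fin; case: ltP => // ba.
by rewrite (le_anti (introT andP (conj ab ba))) subrr.
Qed.

Lemma lebesgue_measure3_parallelepiped (x y z a b c : R) :
  0 <= a -> 0 <= b -> 0 <= c ->
  mu3 ((`[x, x + a] `*` `[y, y + b]) `*` `[z, z + c]) = (a * b * c)%:E.
Proof.
move=> a0 b0 c0; rewrite lebesgue_measure3_box//.
by rewrite !lebesgue_measure_cc ?lerDl// !(addrC _ a) !(addrC _ b) !(addrC _ c) !addrK.
Qed.

(* average *)
Lemma geometric_maximal_gtP (B : set (set (R * R * R))) (f : R * R * R -> R) x (al : R) :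
  (forall A, B A -> exists2 m : R, 0 < m & mu3 A = m%:E) ->
  (al%:E < geometric_maximal B f x)%E <->
  exists2 A, B A /\ A x & (al%:E * mu3 A < \int[mu3]_(y in A) `|f y|%:E)%E.
Proof.
move=> hB.
have key A : B A -> (al%:E < (mu3 A)^-1 * \int[mu3]_(y in A) `|f y|%:E)%E =
   (al%:E * mu3 A < \int[mu3]_(y in A) `|f y|%:E)%E.
  move=> /hB[m m0 ->]; rewrite inver gt_eqF//.
  by rewrite muleC -lte_pdivrMr ?lte_fin//= ?invr_gt0// ?inver ?gt_eqF// invrK.
split.
  move=> /ereal_sup_gt[_ [A /= [BA Ax]] <-]; rewrite key// => h.
  by exists A.
move=> [A [BA Ax] h]; apply: (@lt_le_trans _ _ ((mu3 A)^-1 * \int[mu3]_(y in A) `|f y|%:E)%E).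
  by rewrite key.
by apply: ereal_sup_ubound; exists A.
Qed.

End lebesgue_space3_theory.

(** * Growth of u log^k u *)

Section growth.
Context {R : realType}.

Lemma ge0_logp (u : R) : 0 <= logp u.
Proof. by rewrite /logp le_max lexx orbT. Qed.

Lemma le_logp (u : R) : ln u <= logp u.
Proof. by rewrite /logp le_max lexx. Qed.

Lemma ln2_gt0 : 0 < ln (2 : R).
Proof. by rewrite ln_gt0// ltr1n. Qed.

Lemma log2up_logp (c : R) : 0 < c -> exists2 K : R, 0 < K &
  forall u, 0 < u -> (log2up (c * u))%:R <= K * (1 + logp u).
Proof.
move=> c0; pose l2 := ln (2 : R); have l20 : 0 < l2 by exact: ln2_gt0.
exists (1 + (logp c + 1) / l2).
  by rewrite ltr_pwDl// divr_ge0 ?addr_ge0 ?ge0_logp ?ltW.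
move=> u u0; case E : (log2up (c * u)) => [|m].
  rewrite mulr_ge0// ?addr_ge0 ?ge0_logp//.
  by rewrite divr_ge0 ?addr_ge0 ?ge0_logp ?ltW.
have : 2 ^+ m < c * u by rewrite -ltn_log2up E.
have cu0 : 0 < c * u by rewrite mulr_gt0.
have p20 : 0 < 2 ^+ m :> R by rewrite exprn_gt0.
rewrite -ltr_ln ?posrE//= lnXn// lnM ?posrE// => h.
have h2 : m%:R * l2 <= logp c + logp u.
  rewrite mulr_natl (le_trans (ltW h))// lerD//; exact: le_logp.
have := ge0_logp c; have := ge0_logp u; set x := logp u;
  set y := logp c => x0 y0.
rewrite -(ler_pM2r l20) -natr1.
have -> : (1 + (y + 1) / l2) * (1 + x) * l2 = (l2 + (y + 1)) * (1 + x).
  by field; rewrite gt_eqF.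
rewrite -/x -/y in h2; rewrite mulrDl mul1r; nra.
Qed.

Lemma log2up_le (v w : R) : v <= w -> (log2up v <= log2up w)%N.
Proof.
move=> vw; rewrite leqNgt; apply/negP; rewrite ltn_log2up => h.
by have := lt_le_trans h vw; rewrite -ltn_log2up ltnn.
Qed.

Definition log2_weight k (v : R) : R := (log2up v ^ k * (0 < log2up v))%:R.

(** This replaces Jensen's inequality for a function that is not convex. If u
is at most a / 2, the last term suffices. Otherwise the logarithm of a is
bounded by that of u. When u is averaged and a is its average, the last
term is half of the left-hand side and can be absorbed. *)
Lemma LlogL_young k (c : R) : 0 < c -> exists2 C : R, 0 < C &
  forall a u, 0 <= a -> 0 <= u ->
    u * log2_weight k (c * a) <= C * (u * (1 + logp u) ^+ k) + a * log2_weight k (c * a) / 2.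
Proof.
move=> c0; have [|K K0 hK] := @log2up_logp (2 * c); first by rewrite mulr_gt0.
exists (K ^+ k); first by rewrite exprn_gt0.
move=> a u a0 u0.
have w0 : 0 <= log2_weight k (c * a) by rewrite ler0n.
have P0 : 0 <= K ^+ k * (u * (1 + logp u) ^+ k).
  rewrite mulr_ge0//; first by rewrite exprn_ge0// ltW.
  by rewrite mulr_ge0// exprn_ge0// addr_ge0// ge0_logp.
have [ua|au] := leP u (a / 2).
  rewrite ler_wpDl// mulrAC ler_wpM2r//.
have upos : 0 < u by apply: le_lt_trans au; rewrite divr_ge0.
rewrite ler_wpDr//; first by rewrite divr_ge0// mulr_ge0.
rewrite mulrCA ler_wpM2l// -exprMn.
apply: (@le_trans _ _ ((log2up (2 * c * u))%:R ^+ k)); last first.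
  by rewrite lerXn2r ?nnegrE ?hK// mulr_ge0 ?(ltW K0)// addr_ge0// ge0_logp.
rewrite /log2_weight -natrX ler_nat.
apply: (@leq_trans (log2up (c * a) ^ k)).
  by rewrite -[leqRHS]muln1 leq_mul2l leq_b1 orbT.
have le : (log2up (c * a) <= log2up (2 * c * u))%N.
  apply: log2up_le; rewrite (mulrC 2) -mulrA ler_pM2l//; lra.
by case: (k) => // k'; rewrite leq_exp2r.
Qed.

End growth.

(** * Grids of half-open cells *)

Section grid.
Context {R : realType}.
Variables (d : R) (N : nat).

(** The index is shifted by N so that the natural numbers below 2N give a grid
on both sides of the origin. *)
Definition cell (i : nat) : set R := `[d * (i%:R - N%:R), d * (i.+1%:R - N%:R)[.

Hypothesis d0 : 0 < d.

Lemma cellP i y : cell i y <-> i%:R <= y / d + N%:R < i.+1%:R.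
Proof.
rewrite /cell/= in_itv/= -lerBlDr -ltrBrDr ler_pdivlMr// ltr_pdivrMr//.
by rewrite !(mulrC d).
Qed.

Lemma cell_inj i j y : cell i y -> cell j y -> i = j.
Proof.
move=> /cellP/andP[i1 i2] /cellP/andP[j1 j2].
have := le_lt_trans i1 j2; have := le_lt_trans j1 i2.
by rewrite !ltr_nat; lia.
Qed.

Lemma lebesgue_measure_cell i : lebesgue_measure (cell i) = d%:E.
Proof.
rewrite lebesgue_measure_co; last by rewrite ler_pM2l// lerD2r ler_nat.
by congr (_%:E); rewrite -mulrBr -natr1; ring.
Qed.

(** A mesh of at most half of the length keeps the covering interval of cells
at most twice as long. *)
Lemma grid_cover (x a : R) : 2 * d <= a -> - (d * N%:R) <= x -> x + a < d * N%:R ->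
  exists l m, [/\ (l <= m < N.*2)%N, a <= d * (m - l).+1%:R, d * (m - l).+1%:R <= 2 * a &
    forall y, x <= y <= x + a -> exists2 i, (l <= i <= m)%N & cell i y].
Proof.
move=> da xl xr.
have a0 : 0 <= a by apply: le_trans da; rewrite mulr_ge0// ltW.
pose t y := Num.truncn (y / d + N%:R).
have tP y : x <= y <= x + a -> (t y)%:R <= y / d + N%:R < (t y).+1%:R.
  move=> /andP[xy ya]; apply: truncn_itv; rewrite -lerBlDr sub0r ler_pdivlMr//.
  by rewrite mulNr mulrC (le_trans xl).
have tmono y y' : x <= y -> y <= y' -> y' <= x + a -> (t y <= t y')%N.
  move=> xy yy' ya.
  have /andP[h1 _] := tP y (introT andP (conj xy (le_trans yy' ya))).
  have /andP[_ h2] := tP y' (introT andP (conj (le_trans xy yy') ya)).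
  rewrite -ltnS -(ltr_nat R) (le_lt_trans h1)// (le_lt_trans _ h2)//.
  by rewrite lerD2r ler_pM2r// invr_gt0.
have xx : x <= x <= x + a by rewrite lexx lerDl.
have xa : x <= x + a <= x + a by rewrite lexx lerDl a0.
have lm : (t x <= t (x + a)%R)%N by apply: tmono => //; rewrite lerDl.
exists (t x), (t (x + a)); split.
- rewrite lm/= -(ltr_nat R); have /andP[h _] := tP _ xa; apply: le_lt_trans h _.
  rewrite -addnn natrD ltrD2r ltr_pdivrMr// mulrC //.
- have /andP[_ h] := tP _ xa; have /andP[h' _] := tP _ xx.
  rewrite -subSn// natrB ?(leqW lm)//.
  rewrite -ler_pdivrMl// mulrC; move: h; rewrite mulrDl => h; lra.
- have /andP[h _] := tP _ xa; have /andP[_ h'] := tP _ xx.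
  rewrite -ler_pdivlMl// mulrC -natr1 natrB//; move: h h';
    rewrite mulrDl -!natr1 => h h'.
  have : 2 <= a / d by rewrite ler_pdivlMr.
  lra.
- move=> y /andP[xy ya]; exists (t y); last by apply/cellP/tP/andP.
  by rewrite !tmono// lerDl.
Qed.

Definition cell3 n (p : 'I_n * 'I_n * 'I_n) : set (R * R * R) :=
  (cell p.1.1 `*` cell p.1.2) `*` cell p.2.

Lemma measurable_cell3 n (p : 'I_n * 'I_n * 'I_n) :
  measurable (cell3 p : set (lebesgue_space3 R)).
Proof. by apply: measurable_box3; exact: measurable_itv. Qed.

Lemma lebesgue_measure3_cell3 n (p : 'I_n * 'I_n * 'I_n) :
  lebesgue_measure3 (cell3 p) = (d ^+ 3)%:E.
Proof.
rewrite /cell3 lebesgue_measure3_box; [|exact: measurable_itv..].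
rewrite !lebesgue_measure_cell -!EFinM.
by congr (_%:E); ring.
Qed.

Lemma cell3_inj n (p q : 'I_n * 'I_n * 'I_n) x : cell3 p x -> cell3 q x -> p = q.
Proof.
move: p q => [[p1 p2] p3] [[q1 q2] q3] [[/= a1 a2] a3] [[/= b1 b2] b3].
by congr (_, _, _); apply: val_inj => /=;
  [exact: cell_inj a1 b1|exact: cell_inj a2 b2|exact: cell_inj a3 b3].
Qed.

End grid.

(** * Integrals and measures on an arbitrary measure space *)

Section abstract_measure.
Context d (T : measurableType d) (R : realType).
Variable mu : {measure set T -> \bar R}.
Local Open Scope ereal_scope.

(** The union of cells at mesh 2^-n need not increase with n, so that a
superlevel set is only contained in a lower limit of such unions. As b
does not depend on n, this is enough. *)
Lemma measure_liminf_le (E : (set T)^nat) (b : \bar R) :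
  (forall n, measurable (E n)) -> (forall n, mu (E n) <= b) ->
  mu (\bigcup_m \bigcap_(n in [set n | (m <= n)%N]) E n) <= b.
Proof.
move=> mE Eb; pose D m := \bigcap_(n in [set n | (m <= n)%N]) E n.
have mD m : measurable (D m).
  by apply: bigcap_measurable => //; exists m => /=.
have nD : {homo D : n m / (n <= m)%N >-> (n <= m)%O}.
  move=> n m nm; apply/subsetPset => x Dx k /= mk; apply: Dx => /=.
  exact: leq_trans mk.
have h := nondecreasing_cvg_mu (mu := mu) mD (bigcupT_measurable D mD) nD.
rewrite -(cvg_lim _ h)//; apply: lime_le; first by apply/cvg_ex;
  exists (mu (\bigcup_n D n)).
apply: nearW => n /=; apply: le_trans (Eb n).
by apply: le_measure; rewrite ?inE// => x; apply => /=.
Qed.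

Lemma integral_finite_partition (I : finType) (F : I -> set T) (h : T -> \bar R)
    (J : {set I}) :
  (forall i, measurable (F i)) -> (forall i j x, F i x -> F j x -> i = j) ->
  measurable_fun [set: T] h -> (forall x, 0 <= h x) ->
  \int[mu]_(x in \bigcup_(i in [set` J]) F i) h x = \sum_(i in J) \int[mu]_(x in F i) h x.
Proof.
move=> mF dF mh h0.
have -> : \bigcup_(i in [set` J]) F i = \big[setU/set0]_(i <- enum J) F i.
  by rewrite -bigcup_seq; apply: eq_bigcupl; split => i /=; rewrite mem_enum.
rewrite ge0_integral_bigsetU ?big_enum//.
- exact: enum_uniq.
- by move=> i j _ _ [x [Fix Fjx]]; exact: dF Fix Fjx.
- exact: measurable_funS mh.
Qed.

Lemma measure_finite_partition (I : finType) (F : I -> set T) (J : {set I}) :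
  (forall i, measurable (F i)) -> (forall i j x, F i x -> F j x -> i = j) ->
  mu (\bigcup_(i in [set` J]) F i) = \sum_(i in J) mu (F i).
Proof.
move=> mF dF.
have mU : measurable (\bigcup_(i in [set` J]) F i).
  by apply: fin_bigcup_measurable => //; exact: finite_finset.
transitivity (\int[mu]_(x in \bigcup_(i in [set` J]) F i) cst 1 x).
  by rewrite integral_cst// mul1e.
rewrite integral_finite_partition//.
by apply: eq_bigr => i _; rewrite integral_cst// mul1e.
Qed.

Lemma measurable_LlogL k (g : T -> R) : measurable_fun [set: T] g ->
  measurable_fun [set: T] (fun x => g x * (1 + logp (g x)) ^+ k)%R.
Proof.
move=> mg; apply: measurable_funM => //.
apply: (@measurable_funX _ _ _ _ (fun x => 1 + logp (g x))%R).
apply: measurable_funD => //; apply: (measurableT_comp _ mg).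
by apply: measurable_maxr => //; exact: measurable_ln.
Qed.

Lemma measurable_normr_div (f : T -> R) (al : R) : measurable_fun [set: T] f ->
  measurable_fun [set: T] (fun x => `|f x| / al)%R.
Proof.
move=> mf; apply: measurable_funM => //.
exact: (measurableT_comp (@normr_measurable R [set: R]) mf).
Qed.

(** Integration of [LlogL_young] over D, with a the average of g; the term
with the factor 1/2 is absorbed, which is possible because the average is
finite. *)
Lemma average_LlogL_le k (c : R) : (0 < c)%R -> exists2 K : R, (0 < K)%R &
  forall (D : set T) (m : R) (g : T -> R),
    measurable D -> (0 < m)%R -> mu D = m%:E ->
    measurable_fun [set: T] g -> (forall x, 0 <= g x)%R ->
    \int[mu]_(x in D) (g x)%:E < +oo ->
    (m * LlogL k (c * (fine (\int[mu]_(x in D) (g x)%:E) / m)))%:E <=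
    K%:E * \int[mu]_(x in D) (g x * (1 + logp (g x)) ^+ k)%:E.
Proof.
move=> c0; have [C C0 hC] := @LlogL_young R k c c0.
exists (2 * c * C)%R; first by rewrite !mulr_gt0.
move=> D m g mD m0 muD mg g0 gfin.
set Phi := fun u : R => (u * (1 + logp u) ^+ k)%R.
have mPhi := measurable_LlogL k mg.
have Phi0 x : (0 <= Phi (g x))%R.
  by rewrite /Phi mulr_ge0// exprn_ge0// addr_ge0// ge0_logp.
have mD' (h : T -> R) : measurable_fun [set: T] h -> measurable_fun D (fun x => (h x)%:E).
  by move=> mh; apply/measurable_EFinP; exact: measurable_funS mh.
have I0 : 0 <= \int[mu]_(x in D) (g x)%:E.
  by apply: integral_ge0 => x _; rewrite lee_fin.
set a := (fine _ / m)%R.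
have a0 : (0 <= a)%R by rewrite divr_ge0 ?fine_ge0// ltW.
have am : \int[mu]_(x in D) (g x)%:E = (a * m)%:E.
  by rewrite divfK ?gt_eqF// fineK// ge0_fin_numE.
have W0 : (0 <= log2_weight k (c * a))%R by rewrite ler0n.
have J0 : 0 <= \int[mu]_(x in D) (Phi (g x))%:E.
  by apply: integral_ge0 => x _; rewrite lee_fin.
have key : (a * m * log2_weight k (c * a))%:E <=
    C%:E * \int[mu]_(x in D) (Phi (g x))%:E + (a * log2_weight k (c * a) / 2 * m)%:E.
  rewrite mulrC EFinM -am -ge0_integralZl_EFin//; last 2 first.
    by move=> x _; rewrite lee_fin.
    exact: mD'.
  rewrite [X in _ <= _ + X]EFinM -muD -integral_cst//.
  rewrite -ge0_integralZl_EFin//; last 3 first.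
  - by move=> x _; rewrite lee_fin.
  - exact: mD'.
  - exact: ltW.
  have ac0 : (0 <= a * log2_weight k (c * a) / 2)%R by rewrite divr_ge0// mulr_ge0.
  rewrite -ge0_integralD//; last 2 first.
  - by move=> x _; rewrite mule_ge0// lee_fin// ltW.
  - by apply: measurable_funeM; exact: mD'.
  apply: ge0_le_integral => //.
  - by move=> x _; rewrite mule_ge0// lee_fin.
  - by apply: measurable_funeM; exact: mD'.
  - apply: emeasurable_funD; last exact: measurable_cst.
    by apply: measurable_funeM; exact: mD'.
  - by move=> x _; rewrite -!EFinM -EFinD lee_fin mulrC; exact: hC.
have [Jfin|] := ltP (\int[mu]_(x in D) (Phi (g x))%:E) +oo; last first.
  rewrite leye_eq => /eqP ->; rewrite gt0_muley ?leey//.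
  by rewrite lte_fin !mulr_gt0.
move: key; rewrite -(fineK (x := \int[mu]_(x in D) (Phi (g x))%:E)); last first.
  by rewrite ge0_fin_numE.
rewrite -!EFinM -EFinD !lee_fin => key.
have -> : LlogL k (c * a) = (c * a * log2_weight k (c * a))%R by [].
rewrite -subr_ge0.
set J := fine _ in key *; set W := log2_weight _ _ in key *.
have -> : (2 * c * C * J - m * (c * a * W) =
   2 * c * (C * J + a * W / 2 * m - a * m * W))%R by field.
by rewrite mulr_ge0 ?subr_ge0// mulr_ge0// ltW.
Qed.

Lemma integral_scaled_indic (E : set T) (c e : R) : measurable E -> mu E = e%:E ->
  (0 <= c)%R -> \int[mu]_x (c * \1_E x)%:E = (c * e)%:E.
Proof.
move=> mE muE c0; under eq_integral do rewrite EFinM.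
rewrite ge0_integralZl_EFin//; first by rewrite integral_indic// setIT muE.
by apply/measurable_EFinP; exact: measurable_indic.
Qed.


Lemma integral_normr_indic (D E : set T) : measurable D -> measurable E ->
  \int[mu]_(x in D) `|\1_E x : R|%:E = mu (E `&` D).
Proof.
move=> mD mE; rewrite -integral_indic//; apply: eq_integral => x _.
by rewrite ger0_norm.
Qed.


End abstract_measure.

(** * From a grid to three-dimensional space *)

Section discretization.
Context {R : realType}.
Local Notation T3 := (lebesgue_space3 R).
Local Notation mu3 := (@lebesgue_measure3 R).
Variables (g : T3 -> R) (d : R) (N : nat).
Hypotheses (mg : measurable_fun [set: T3] g) (g0 : forall x, 0 <= g x) (d0 : 0 < d).
Local Notation n := N.*2.
Local Notation cell3 := (cell3 d N).

Definition grid_avg (p : 'I_n * 'I_n * 'I_n) : R :=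
  fine (\int[mu3]_(x in cell3 p) (g x)%:E)%E / d ^+ 3.

Lemma grid_avg_ge0 p : 0 <= grid_avg p.
Proof.
rewrite /grid_avg divr_ge0 ?exprn_ge0 ?(ltW d0)//; apply: fine_ge0.
by apply: integral_ge0 => x _; rewrite lee_fin.
Qed.

(** The factor 8 is the volume ratio that is lost when a box is replaced by a
box of cells, a factor 2 for each side. *)
Definition grid_superlevel (F : {set {set 'I_n * 'I_n * 'I_n}}) : {set 'I_n * 'I_n * 'I_n} :=
  [set p | (1 : R) < maxop F (fun q => 8 * grid_avg q) p]%SET.

Lemma grid_superlevel_le k (C c K : R) (F : {set {set 'I_n * 'I_n * 'I_n}}) :
  0 <= C -> 0 <= K -> weak_LlogL k C c F ->
  measurable_fun [set: T3] (fun x => (g x * (1 + logp (g x)) ^+ k)%:E) ->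
  (forall p : 'I_n * 'I_n * 'I_n, (d ^+ 3 * LlogL k (c * 8 * grid_avg p))%:E <=
     K%:E * \int[mu3]_(x in cell3 p) (g x * (1 + logp (g x)) ^+ k)%:E)%E ->
  (mu3 (\bigcup_(p in [set` grid_superlevel F]) cell3 p) <=
     (C * K)%:E * \int[mu3]_x (g x * (1 + logp (g x)) ^+ k)%:E)%E.
Proof.
move=> C0 K0 wF mPhi hK; set Phi := (X in measurable_fun _ X) in mPhi.
have mc := @measurable_cell3 _ d N n.
have Phi0 x : (0 <= Phi x)%E.
  by rewrite lee_fin mulr_ge0// exprn_ge0// addr_ge0// ge0_logp.
rewrite (measure_finite_partition mu3 (grid_superlevel F) mc);
  last exact: cell3_inj.
rewrite (eq_bigr (fun=> (d ^+ 3)%:E)); last first.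
  by move=> p _; exact: lebesgue_measure3_cell3.
rewrite sumEFin sumr_const -(mulr_natr (d ^+ 3)).
have := wF (fun q => 8 * grid_avg q) (fun q =>
  mulr_ge0 (ler0n _ _) (grid_avg_ge0 q)).
rewrite -/(grid_superlevel F) => h.
apply: (@le_trans _ _ (C%:E * \sum_p (d ^+ 3 * LlogL k (c * 8 * grid_avg p))%:E)%E).
  rewrite sumEFin -EFinM lee_fin -mulr_sumr mulrCA ler_wpM2l ?exprn_ge0 ?(ltW d0)//.
  by apply: (le_trans h); rewrite ler_wpM2l//; apply: ler_sum => p _;
    rewrite mulrA.
rewrite EFinM -muleA lee_wpmul2l ?lee_fin//.
apply: (@le_trans _ _ (\sum_p K%:E * \int[mu3]_(x in cell3 p) Phi x)%E).
  by apply: lee_sum => p _; exact: hK.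
rewrite -ge0_sume_distrr; last by move=> p _; apply: integral_ge0 => x _.
rewrite lee_wpmul2l ?lee_fin//.
have := integral_finite_partition mu3 [set: 'I_n * 'I_n * 'I_n]%SET mc
  (@cell3_inj _ d N d0 n) mPhi Phi0.
rewrite (eq_bigl predT); last by move=> p; rewrite inE.
move=> <-; apply: ge0_subset_integral => //.
by apply: fin_bigcup_measurable => //; exact: finite_finset.
Qed.

(** The box A is covered by a box of cells that is at most twice as long in
each direction and belongs to the family; its average is at least 1/8 of
that over A, and every cell of it belongs to the superlevel set. *)
Lemma sub_grid_superlevel (F : {set {set 'I_n * 'I_n * 'I_n}}) (x y z a b c : R) :
  (\int[mu3]_x (g x)%:E < +oo)%E ->
  2 * d <= a -> 2 * d <= b -> 2 * d <= c ->
  - (d * N%:R) <= x -> x + a < d * N%:R ->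
  - (d * N%:R) <= y -> y + b < d * N%:R ->
  - (d * N%:R) <= z -> z + c < d * N%:R ->
  (forall I J K : {set 'I_n}, I \in index_itvs n -> J \in index_itvs n -> K \in index_itvs n ->
     a <= d * #|I|%:R <= 2 * a -> b <= d * #|J|%:R <= 2 * b ->
     c <= d * #|K|%:R <= 2 * c ->
     finset.setX (finset.setX I J) K \in F) ->
  let A := (`[x, x + a] `*` `[y, y + b]) `*` `[z, z + c] in
  ((a * b * c)%:E < \int[mu3]_(u in A) (g u)%:E)%E ->
  A `<=` \bigcup_(p in [set` grid_superlevel F]) cell3 p.
Proof.
move=> gfin da db dc xl xr yl yr zl zr hF A hA.
have [l1 [m1 [lm1 a1 a2 cov1]]] := grid_cover d0 da xl xr.
have [l2 [m2 [lm2 b1 b2 cov2]]] := grid_cover d0 db yl yr.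
have [l3 [m3 [lm3 c1 c2 cov3]]] := grid_cover d0 dc zl zr.
pose I := index_itv n l1 m1; pose J := index_itv n l2 m2;
  pose K := index_itv n l3 m3.
pose Q := finset.setX (finset.setX I J) K.
have cI : #|I| = (m1 - l1).+1 by exact: card_index_itv.
have cJ : #|J| = (m2 - l2).+1 by exact: card_index_itv.
have cK : #|K| = (m3 - l3).+1 by exact: card_index_itv.
have QF : Q \in F.
  apply: hF; rewrite ?mem_index_itvs//.
  - by rewrite cI a1.
  - by rewrite cJ b1.
  - by rewrite cK c1.
have AQ u : A u -> exists2 p, p \in Q & cell3 p u.
  move: u => [[u1 u2] u3] [[/= A1 A2] A3].
  have [|i1 hi1 ci1] := cov1 u1; first by move: A1; rewrite in_itv.
  have [|i2 hi2 ci2] := cov2 u2; first by move: A2; rewrite in_itv.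
  have [|i3 hi3 ci3] := cov3 u3; first by move: A3; rewrite in_itv.
  have j1 : (i1 < n)%N by case/andP: hi1 => _ /leq_ltn_trans; apply;
    case/andP: lm1.
  have j2 : (i2 < n)%N by case/andP: hi2 => _ /leq_ltn_trans; apply;
    case/andP: lm2.
  have j3 : (i3 < n)%N by case/andP: hi3 => _ /leq_ltn_trans; apply;
    case/andP: lm3.
  exists (Ordinal j1, Ordinal j2, Ordinal j3); last by split.
  by rewrite !inE/= hi1 hi2 hi3.
have mA : measurable (A : set T3) by apply: measurable_box3;
  exact: measurable_itv.
have mgE (D : set T3) : measurable_fun D (fun x => (g x)%:E).
  by apply/measurable_EFinP; exact: measurable_funS mg.
have gE0 u : (0 <= (g u)%:E)%E by rewrite lee_fin.
have mc := @measurable_cell3 _ d N n.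
have intQ : (\int[mu3]_(u in A) (g u)%:E <= (d ^+ 3 * \sum_(p in Q) grid_avg p)%:E)%E.
  have := integral_finite_partition mu3 Q mc (@cell3_inj _ d N d0 n) (mgE _) gE0.
  rewrite (eq_bigr (fun p => (d ^+ 3 * grid_avg p)%:E)); last first.
    move=> p _; rewrite /grid_avg mulrC divfK ?gt_eqF ?exprn_gt0// fineK//.
    rewrite ge0_fin_numE ?integral_ge0//; apply: le_lt_trans gfin.
    by apply: ge0_subset_integral => //; exact: mgE.
  rewrite sumEFin -mulr_sumr => <-; apply: ge0_subset_integral => //.
  by apply: fin_bigcup_measurable => //; exact: finite_finset.
move=> u /AQ[p pQ cp]; exists p => //=; rewrite inE.
apply/maxop_gtP => //; exists Q => //; rewrite mul1r -mulr_sumr.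
have := lt_le_trans hA intQ; rewrite lte_fin => h.
have d3 : 0 < d ^+ 3 by rewrite exprn_gt0.
rewrite -(ltr_pM2l d3) mulrCA; apply: le_lt_trans (_ : 8 * (a * b * c) < _);
  last first.
  by rewrite ltr_pM2l.
rewrite !cardsX cI cJ cK !natrM.
have -> : d ^+ 3 * ((m1 - l1).+1%:R * (m2 - l2).+1%:R * (m3 - l3).+1%:R) =
  (d * (m1 - l1).+1%:R) * (d * (m2 - l2).+1%:R) * (d * (m3 - l3).+1%:R) by ring.
have -> : 8 * (a * b * c) = (2 * a) * (2 * b) * (2 * c) by ring.
have p0 m : 0 <= d * m%:R by rewrite mulr_ge0// ltW.
by apply: ler_pM => //; [rewrite mulr_ge0|apply: ler_pM].
Qed.

End discretization.

Section transference.
Context {R : realType}.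
Local Notation T3 := (lebesgue_space3 R).
Local Notation mu3 := (@lebesgue_measure3 R).

(** The condition on A is that every box of indices which approximates A on
some grid belongs to the family. *)
Definition grid_family (F : forall n, {set {set 'I_n * 'I_n * 'I_n}})
    (A : set (R * R * R)) := exists x y z a b c : R,
  [/\ [/\ 0 < a, 0 < b & 0 < c],
      A = (`[x, x + a] `*` `[y, y + b]) `*` `[z, z + c] &
      forall n d (I J K : {set 'I_n}), 0 < d ->
        I \in index_itvs n -> J \in index_itvs n -> K \in index_itvs n ->
        a <= d * #|I|%:R <= 2 * a -> b <= d * #|J|%:R <= 2 * b ->
        c <= d * #|K|%:R <= 2 * c ->
        finset.setX (finset.setX I J) K \in F n].

(** The grid at step n has mesh 2^-n and covers the interval from -2^n to 2^n:
it is eventually fine enough, and large enough, for any given interval. *)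
Lemma near_grid (x a : R) : 0 < a -> exists m, forall n, (m <= n)%N ->
  [/\ 2 * (2 ^+ n)^-1 <= a, - ((2 ^+ n)^-1 * (4 ^ n)%:R) <= x &
      x + a < (2 ^+ n)^-1 * (4 ^ n)%:R].
Proof.
move=> a0; have [m hm] := ex_pow2_ge (`|x| + a + 1 + 2 / a); exists m => n mn.
have p0 : 0 < 2 ^+ n :> R by rewrite exprn_gt0.
have -> : (2 ^+ n)^-1 * (4 ^ n)%:R = 2 ^+ n :> R.
  by rewrite (_ : 4 = 2 * 2)%N// expnMn natrM natrX mulKf// gt_eqF.
have h : `|x| + a + 1 + 2 / a <= 2 ^+ n.
  by apply: (le_trans hm); rewrite ler_weXn2l// ler1n.
have i0 : 0 < 2 / a by rewrite divr_gt0.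
have := ler_norm x; have := ler_norm (- x); rewrite normrN => h1 h2.
split; [|lra|lra].
rewrite ler_pdivrMr// -ler_pdivrMl// mulrC.
have := normr_ge0 x; lra.
Qed.

(** When f / alpha is not in the class, the right-hand side is infinite.
Otherwise the bound at each step of the grid is uniform, and a point of
the superlevel set belongs to the union of cells at every sufficiently
fine step. *)
Lemma weak_type_of_grid k (C c : R) (F : forall n, {set {set 'I_n * 'I_n * 'I_n}}) B :
  0 < C -> 0 < c -> (forall n, weak_LlogL k C c (F n)) ->
  (forall A, B A -> grid_family F A) ->
  weak_type_estimate B (fun u => u * (1 + logp u) ^+ k).
Proof.
move=> C0 c0 wF hB.
have [K K0 hK] := @average_LlogL_le _ _ _ mu3 k (c * 8) (mulr_gt0 c0 (ltr0n _ 8)).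
exists (C * K) => f al mf al0.
pose g (x : T3) := `|f x| / al.
have g0 x : 0 <= g x by rewrite /g divr_ge0// ltW.
have mg : measurable_fun [set: T3] g.
  exact: measurable_normr_div.
have mPhi : measurable_fun [set: T3] (fun x =>
  (g x * (1 + logp (g x)) ^+ k)%:E).
  by apply/measurable_EFinP; exact: measurable_LlogL.
have Phi0 x : 0 <= g x * (1 + logp (g x)) ^+ k.
  by rewrite mulr_ge0// exprn_ge0// addr_ge0// ge0_logp.
have Phig x : g x <= g x * (1 + logp (g x)) ^+ k.
  by rewrite ler_peMr// exprn_ege1// lerDl ge0_logp.
have [Ifin|] := ltP (\int[mu3]_x (g x * (1 + logp (g x)) ^+ k)%:E)%E +oo%E;
  last first.
  by rewrite leye_eq => /eqP ->; rewrite gt0_muley ?leey// lte_fin mulr_gt0.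
have mgE (D : set T3) : measurable_fun D (fun x => (g x)%:E).
  by apply/measurable_EFinP; exact: measurable_funS mg.
have gfin : (\int[mu3]_x (g x)%:E < +oo)%E.
  apply: le_lt_trans Ifin; apply: ge0_le_integral => //.
  - by move=> x _; rewrite lee_fin.
  - by move=> x _; rewrite lee_fin.
pose d n : R := (2 ^+ n)^-1.
have d0 n : 0 < d n by rewrite invr_gt0 exprn_gt0.
pose H n := grid_superlevel g (d n) (F (4 ^ n).*2).
pose E n : set T3 := \bigcup_(p in [set` H n]) cell3 (d n) (4 ^ n) p.
have mE n : measurable (E n).
  apply: fin_bigcup_measurable; first exact: finite_finset.
  by move=> p _; exact: measurable_cell3.
have Eb n : (mu3 (E n) <= (C * K)%:E * \int[mu3]_x (g x * (1 + logp (g x)) ^+ k)%:E)%E.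
  apply: (grid_superlevel_le g0 (d0 n) (ltW C0) (ltW K0) (wF _) mPhi) => p.
  apply: hK => //.
  - exact: measurable_cell3.
  - by rewrite exprn_gt0.
  - exact: lebesgue_measure3_cell3.
  - by apply: le_lt_trans gfin; apply: ge0_subset_integral => //;
      [exact: measurable_cell3|move=> y _; rewrite lee_fin].
have := measure_liminf_le mE Eb; apply: le_trans; apply: le_lebesgue_measure3.
move=> x /= /geometric_maximal_gtP[|A [BA Ax]].
  move=> A /hB[x1 [x2 [x3 [a [b [c' [[a0 b0 c'0] -> _]]]]]]].
  by exists (a * b * c'); [rewrite !mulr_gt0|rewrite lebesgue_measure3_parallelepiped// ltW].
have [x1 [x2 [x3 [a [b [c' [[a0 b0 c'0] EA hA]]]]]]] := hB _ BA.
rewrite EA lebesgue_measure3_parallelepiped ?ltW// -EA => hlt.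
have hg : ((a * b * c')%:E < \int[mu3]_(u in A) (g u)%:E)%E.
  have alfin : al%:E \is a fin_num by [].
  have al1 : (0 < al%:E)%E by rewrite lte_fin.
  rewrite -(lte_pmul2l alfin al1).
  rewrite -ge0_integralZl_EFin//; last 3 first.
  - by rewrite EA; apply: measurable_box3; exact: measurable_itv.
  - by move=> u _; rewrite lee_fin.
  - exact: ltW.
  rewrite (eq_integral (fun u => `|f u|%:E))// => u _.
  by rewrite /g -EFinM mulrC divfK// gt_eqF.
have [m1 h1] := near_grid x1 a0; have [m2 h2] := near_grid x2 b0.
have [m3 h3] := near_grid x3 c'0.
exists (maxn m1 (maxn m2 m3)) => // n /=; rewrite !geq_max => /and3P[n1 n2 n3].
have [a1 a2 a3] := h1 _ n1; have [b1 b2 b3] := h2 _ n2;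
  have [e1 e2 e3] := h3 _ n3.
apply: (@sub_grid_superlevel _ g (d n) (4 ^ n) mg g0 (d0 n) _ x1 x2 x3 a b c') => //.
- by move=> I J L; apply: hA.
- by rewrite -EA.
- by rewrite -EA.
Qed.

End transference.

(** * The two weak type estimates *)

Section upper_estimates.
Context {R : realType}.
Variables (S : set int) (B : set (set (R * R * R))).
Hypothesis SB : dyadic_zygmund_collection S B.

Lemma exp2z_gt0 (j : int) : 0 < (2 : R) ^ j.
Proof. by rewrite exprz_gt0. Qed.

Lemma weak_type_strong : weak_type_estimate B (fun u => u * (1 + logp u) ^+ 2).
Proof.
have [C [c [C0 c0 w]]] := @weak_LlogL_boxes R.
apply: (weak_type_of_grid C0 c0 w) => A /(let: And3 _ h _ := SB in h).
move=> [s [t [j [s0 t0 Sj [x [y [z ->]]]]]]].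
exists x, y, z, s, (2 ^ j * s), t; split => //.
  by split => //; rewrite mulr_gt0// exp2z_gt0.
move=> n d I J K d0 I1 J1 K1 _ _ _.
by apply/imset2P; exists (finset.setX I J) K => //; apply/imset2P; exists I J.
Qed.

Lemma finite_set_int_bound (A : set int) : finite_set A ->
  exists D : nat, forall j, A j -> (`|j| <= D)%N.
Proof.
move=> /finite_seqP[s ->]; exists (\max_(j <- s) `|j|)%N => j /= js.
exact: leq_bigmax_seq.
Qed.

Lemma exp2z_le (j : int) D : (`|j| <= D)%N -> (2 : R) ^ j <= 2 ^+ D.
Proof.
move=> jD; apply: (@le_trans _ _ (2 ^ `|j|)).
  by rewrite ler_weXz2l ?ler1n// ler_norm.
by rewrite -abszE; apply: (@ler_weXn2l R 2) => //; rewrite ler1n.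
Qed.

Lemma weak_type_Zygmund : finite_set S ->
  weak_type_estimate B (fun u => u * (1 + logp u)).
Proof.
move=> /finite_set_int_bound[D hD].
have [C [c [C0 c0 w]]] := @weak_LlogL_fat_boxes R (2 * 2 ^ D).
apply: (weak_type_of_grid (k := 1) C0 c0 w) => A /(let: And3 _ h _ := SB in h).
move=> [s [t [j [s0 t0 Sj [x [y [z ->]]]]]]].
have js0 : 0 < 2 ^ j * s by rewrite mulr_gt0// exp2z_gt0.
exists x, y, z, s, (2 ^ j * s), t; split => //.
move=> n d I J K d0 I1 J1 K1 /andP[a1 a2] /andP[b1 b2] _.
apply/imset2P; exists (finset.setX I J) K => //; apply/fat_rectsP; exists I, J;
  split => //.
- rewrite -(ler_nat R) !natrM natrX -(ler_pM2l d0); apply: (le_trans a2).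
  rewrite [leRHS]mulrCA -[leRHS]mulrA ler_pM2l//;
    apply: (@le_trans _ _ (2 ^+ D * (2 ^ j * s))); last first.
    by rewrite ler_wpM2l// exprn_ge0.
  rewrite mulrA ler_peMl ?(ltW s0)//.
  rewrite [leLHS](_ : 1 = 2 ^ (- j) * 2 ^ j); last by rewrite -expfzDr// addNr.
  by rewrite ler_wpM2r ?(ltW (exp2z_gt0 j))// exp2z_le// abszN hD.
- rewrite -(ler_nat R) !natrM natrX -(ler_pM2l d0); apply: (le_trans b2).
  rewrite [leRHS]mulrCA -[leRHS]mulrA ler_pM2l//;
    apply: (@le_trans _ _ (2 ^+ D * s)); last first.
    by rewrite ler_wpM2l// exprn_ge0.
  by rewrite ler_wpM2r ?(ltW s0)// exp2z_le// hD.
Qed.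

End upper_estimates.

(** * Sets defined by binary digits *)

Section binary_digits.
Context {R : realType}.
Local Notation mu1 := (@lebesgue_measure R).

(** Both sides are measures that agree on half-open intervals. *)
Lemma lebesgue_measure_shift (h : R) (A : set R) : measurable A ->
  mu1 [set x | A (x - h)] = mu1 A.
Proof.
move=> mA; pose s : R -> measurableTypeR R := fun x => x - h.
have ms : measurable_fun [set: measurableTypeR R] s.
  by apply: measurable_funB => //; exact: measurable_id.
rewrite -[LHS]/(pushforward mu1 s A).
apply/esym/lebesgue_measure_unique => //= _ [[a b]] _ <-.
rewrite /pushforward (_ : s @^-1` _ = `]a + h, b + h]%classic).
  by rewrite !lebesgue_measure_itv/= !lte_fin ltrD2r -!EFinB opprD addrACA subrr addr0.
by apply/seteqP; split => x /=; rewrite !in_itv/= /s ltrBrDr lerBlDr.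
Qed.

Definition grid_index (p : nat) (x : R) : nat := Num.truncn (2 ^+ p * x).

Lemma grid_indexP p (x : R) n : 0 <= x ->
  (grid_index p x == n) = (n%:R <= 2 ^+ p * x < n.+1%:R).
Proof.
move=> x0; have p0 : 0 <= 2 ^+ p * x by rewrite mulr_ge0// exprn_ge0.
have /andP[h1 h2] := truncn_itv p0.
apply/eqP/idP => [<-|/andP[h3 h4]]; first by rewrite h1 h2.
have := le_lt_trans h1 h4; have := le_lt_trans h3 h2.
by rewrite !ltr_nat /grid_index; lia.
Qed.

Lemma grid_index_div p r (x : R) : 0 <= x ->
  grid_index p x = (grid_index (p + r) x %/ 2 ^ r)%N.
Proof.
move=> x0; apply/eqP; rewrite grid_indexP//.
have : grid_index (p + r) x == grid_index (p + r) x by [].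
rewrite grid_indexP//; set n := grid_index _ _ => /andP[h1 h2].
have r0 : 0 < (2 : R) ^+ r by rewrite exprn_gt0.
have rN : (0 < 2 ^ r)%N by rewrite expn_gt0.
rewrite -(ler_pM2r r0) -(ltr_pM2r r0) -natrX -!natrM.
have -> : 2 ^+ p * x * (2 ^ r)%:R = 2 ^+ (p + r) * x by rewrite natrX exprD mulrAC.
apply/andP; split.
  by apply: le_trans h1; rewrite ler_nat leq_trunc_div.
by apply: (lt_le_trans h2); rewrite ler_nat ltn_ceil.
Qed.

(** For a set of nonnegative reals, to be a union of intervals of length 2^-p
with end points in the multiples of 2^-p. *)
Definition dyadic (p : nat) (A : set R) :=
  A `<=` [set x | 0 <= x] /\
  forall x y, 0 <= y -> grid_index p x = grid_index p y -> A x -> A y.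

Lemma dyadicW p q (A : set R) : (p <= q)%N -> dyadic p A -> dyadic q A.
Proof.
move=> pq [A0 Ap]; split => // x y y0 xy Ax; apply: Ap (Ax) => //.
have x0 := A0 _ Ax.
by rewrite (@grid_index_div p (q - p) x)// (@grid_index_div p (q - p) y)// subnKC// xy.
Qed.

Lemma measurable_dyadic p (A : set R) : dyadic p A -> measurable A.
Proof.
move=> [A0 Ap]; pose I n : set R := [set x | 0 <= x /\ grid_index p x = n].
have mI n : measurable (I n).
  have -> : I n = `[n%:R / 2 ^+ p, n.+1%:R / 2 ^+ p[%classic.
    have p0 : 0 < (2 : R) ^+ p by rewrite exprn_gt0.
    apply/seteqP; split => x /=; rewrite in_itv/= ler_pdivrMr// ltr_pdivlMr// ![x * _]mulrC.
      by move=> [x0 /eqP]; rewrite grid_indexP.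
    move=> h; have x0 : 0 <= x.
      have : 0 <= 2 ^+ p * x by case/andP: h => h _; apply: le_trans h.
      by rewrite pmulr_rge0.
    by split => //; apply/eqP; rewrite grid_indexP.
  exact: measurable_itv.
have -> : A = \bigcup_(n in [set n | exists2 x, A x & grid_index p x = n]) I n.
  apply/seteqP; split => x.
    by move=> Ax; exists (grid_index p x); [exists x|split => //; exact: A0].
  by move=> [n [y Ay yn] [x0 xn]]; apply: Ap Ay; rewrite // yn xn.
exact: bigcup_measurable.
Qed.

(** The p-th binary digit after the point vanishes. *)
Definition even_digit (p : nat) : set R := [set x | ~~ odd (grid_index p x)].

Lemma dyadic_even_digit p q (A : set R) : (p <= q)%N -> dyadic p A ->
  dyadic q (A `&` even_digit q).
Proof.
move=> pq /(dyadicW pq)[A0 Aq]; split; first by move=> x [/A0].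
by move=> x y y0 xy [Ax ex]; split; [exact: Aq Ax|rewrite /even_digit/= -xy].
Qed.

(** Translation by 2^-q changes the digit of order q from 0 to 1 and leaves
the previous ones alone. Hence it maps the points of A with digit 0 onto
those with digit 1, and both halves have the same measure. *)
Lemma measure_even_digit p q (A : set R) : (p < q)%N -> dyadic p A ->
  (mu1 A = 2%:E * mu1 (A `&` even_digit q))%E.
Proof.
move=> pq dA; have mA := measurable_dyadic dA.
have mE := measurable_dyadic (dyadic_even_digit (ltnW pq) dA).
have [A0 Ap] := dA.
pose h : R := (2 ^+ q)^-1.
have q0 : 0 < (2 : R) ^+ q by rewrite exprn_gt0.
have h0 : 0 < h by rewrite invr_gt0.
have shift x : 0 <= x -> grid_index q (x + h) = (grid_index q x).+1.
  move=> x0; apply/eqP; rewrite grid_indexP ?addr_ge0 ?(ltW h0)//.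
  rewrite mulrDr divff ?gt_eqF// -[in X in X <= _]natr1 -[in X in _ < X]natr1.
  by rewrite lerD2r ltrD2r -grid_indexP.
(* Adding h to an even multiple of h produces no carry. *)
have same x : 0 <= x -> ~~ odd (grid_index q x) -> grid_index p (x + h) = grid_index p x.
  move=> x0 ex; rewrite (@grid_index_div p (q - p) x)//.
  rewrite (@grid_index_div p (q - p) (x + h)) ?addr_ge0 ?(ltW h0)//.
  rewrite subnKC ?(ltnW pq)// shift//.
  case E : (q - p)%N => [|r]; first by move: pq; rewrite -subn_gt0 E.
  by rewrite expnS !divnMA !divn2 /= uphalf_half (negPf ex).
have -> : mu1 A = (mu1 (A `&` even_digit q) + mu1 (A `\` (A `&` even_digit q)))%E.
  rewrite -measureU//.
  - by rewrite setDE setUIr setUv setIT; congr (mu1 _);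
    rewrite setUidr// => x [].
  - exact: measurableD.
  - by rewrite setDE setICA setICr setI0.
rewrite (_ : A `\` _ = [set x | (A `&` even_digit q) (x - h)]); last first.
  apply/seteqP; split => x.
    move=> [Ax nx]; have x0 := A0 _ Ax.
    have ox : odd (grid_index q x) by apply: contra_notT nx => ?; split.
    have gx : 0 <= x - h.
      rewrite subr_ge0 -[h]mul1r ler_pdivrMr// mulrC.
      have : grid_index q x == grid_index q x by [].
      rewrite grid_indexP// => /andP[+ _]; apply: le_trans.
      by rewrite ler1n; case: (grid_index q x) ox.
    have := shift _ gx; rewrite subrK => e.
    have ex : ~~ odd (grid_index q (x - h)) by move: ox; rewrite e.
    split => //; apply: Ap Ax => //.
    by rewrite -(same _ gx ex) subrK.
  move=> [Ax ex]; have x0 := A0 _ Ax; split.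
    by apply: Ap Ax; rewrite -?(same _ x0 ex) ?subrK//;
      rewrite -(subrK h x) addr_ge0// ltW.
  by move=> [_]; rewrite /even_digit/= -(subrK h x) shift//= negbK; apply/negP.
rewrite lebesgue_measure_shift//.
by rewrite -[X in (X + _)%E]mul1e -[X in (_ + X)%E]mul1e -ge0_muleDl.
Qed.

Lemma measure_even_digits (ms : nat -> nat) p i r (A : set R) :
  {homo ms : a b / (a < b)%N} -> (p < ms i)%N -> dyadic p A ->
  dyadic (ms (i + r)%N).-1 (A `&` [set x | forall l, (i <= l < i + r)%N ->
    even_digit (ms l) x]) /\
  (mu1 A = (2 ^+ r)%:E * mu1 (A `&` [set x | forall l, (i <= l < i + r)%N ->
    even_digit (ms l) x]))%E.
Proof.
move=> mono pi dA; elim: r => [|r [IHd IHm]].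
  rewrite !addn0; have -> : A `&` [set x | forall l, (i <= l < i)%N -> even_digit (ms l) x] = A.
    by apply/seteqP; split => [x []//|x Ax]; split => // l; case: leqP.
  split; last by rewrite expr0 mul1e.
  by apply: dyadicW dA; rewrite -ltnS prednK//; case: (ms i) pi.
rewrite addnS; set V := A `&` _ in IHd IHm *.
have pos : (0 < ms (i + r)%N)%N.
  by have [->|r0] := posnP r; [rewrite addn0; case: (ms i) pi|
    apply: leq_ltn_trans (mono i _ _) => //;
      rewrite -[X in (X < _)%N]addn0 ltn_add2l].
have -> : A `&` [set x | forall l, (i <= l < (i + r).+1)%N -> even_digit (ms l) x] =
    V `&` even_digit (ms (i + r)%N).
  apply/seteqP; split => x.
    move=> [Ax h]; split; [split => //|] => [l /andP[il lr]|]; apply: h.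
      by rewrite il ltnS ltnW.
    by rewrite leq_addr leqnn.
  move=> [[Ax h] hr]; split => // l /andP[il]; rewrite ltnS leq_eqVlt.
  by case/orP => [/eqP -> //|lr]; apply: h; rewrite il.
have lt : ((ms (i + r)%N).-1 < ms (i + r)%N)%N by rewrite prednK.
split.
  apply: dyadicW (dyadic_even_digit (ltnW lt) IHd).
  by rewrite -ltnS prednK; have := mono (i + r)%N (i + r).+1 (ltnSn _);
    [|case: (ms _.+1)].
by rewrite IHm (measure_even_digit lt IHd) exprSr EFinM muleA.
Qed.

End binary_digits.

Section cantor_sets.
Context {R : realType}.
Local Notation mu1 := (@lebesgue_measure R).

Lemma dyadic_cell p (q : nat) :
  dyadic p (`[(q%:R : R) / 2 ^+ p, q.+1%:R / 2 ^+ p[%classic : set R).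
Proof.
have p0 : 0 < (2 : R) ^+ p by rewrite exprn_gt0.
split.
  by move=> x /=; rewrite in_itv/= => /andP[+ _]; apply: le_trans;
    rewrite divr_ge0// ltW.
move=> x y y0 xy; rewrite /= !in_itv/= !ler_pdivrMr// !ltr_pdivlMr// ![_ * 2 ^+ p]mulrC => hx.
have x0 : 0 <= x.
  have : 0 <= 2 ^+ p * x by case/andP: hx => h _; apply: le_trans h.
  by rewrite pmulr_rge0.
by rewrite -grid_indexP// -xy grid_indexP.
Qed.

(** The digits v 1 < v 2 < ... are chosen one after the other, so that between
v i and v (i+1) there is a p with p + b in Sp for each b at most m: take j
in Sp with j at least v i + m, put p = j - b and v (i+1) = j + 1. Then X a
consists of the points of the unit interval whose first m - a chosen
digits vanish. On an interval of length 2^-p in X a, with p between the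
last digit used and the next one, the a digits that remain divide the
measure by 2^a. *)
Lemma cantor_sets (Sp : nat -> Prop) m : (forall n, exists2 j, (n <= j)%N & Sp j) ->
  exists X : nat -> set R,
  [/\ forall a, measurable (X a), forall a, (a < m)%N -> X a `<=` X a.+1,
      forall a, (a <= m)%N -> mu1 (X a) = (2 ^+ a / 2 ^+ m)%:E &
      forall a b x, (a <= m)%N -> (b <= m)%N -> X a x ->
        exists p y, [/\ Sp (p + b)%N, y <= x <= y + (2 ^+ p)^-1 &
          (((2 ^+ a)^-1 * (2 ^+ p)^-1)%:E <=
             mu1 (X 0%N `&` `[y, (y + (2 ^+ p)^-1)%R]))%E]].
Proof.
move=> unb; have [nx hnx] : exists nx : nat -> nat, forall n, (n <= nx n)%N /\ Sp (nx n).
  by exists (fun n => s2val (cid2 (unb n))) => n; case: cid2.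
(* v i bounds the first i chosen digits, whose positions are ms 0, ..., ms (i-1). *)
pose v i := iter i (fun w => (nx (w + m)%N).+1) 0%N.
pose ms i := v i.+1.
have vlt i : (v i < v i.+1)%N.
  by rewrite /v /= ltnS; apply: leq_trans (hnx _).1; exact: leq_addr.
have vmono : {homo v : a b / (a < b)%N} by apply: homo_ltn => //;
  exact: ltn_trans.
have msmono : {homo ms : a b / (a < b)%N} by move=> a b ab; apply: vmono.
pose A0 : set R := `[0, 1[%classic.
have dA0 : dyadic 0 A0.
  have := dyadic_cell 0 0; rewrite expr0 !divr1 -[0%:R]/(0 : R) -[1%:R]/(1 : R).
  exact.
pose W i := A0 `&` [set x | forall l, (0 <= l < 0 + i)%N -> even_digit (ms l) x].
have ms0 : (0 < ms 0)%N by rewrite /ms/= (leq_ltn_trans _ (vlt 0%N)).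
have hW i := measure_even_digits i msmono ms0 dA0.
have mu0 : mu1 A0 = 1%:E by rewrite lebesgue_measure_co// subr0.
have muW i : mu1 (W i) = ((2 ^+ i)^-1)%:E.
  have [_] := hW i; rewrite mu0 -/(W i) => e.
  have p2 : (0 : R) < 2 ^+ i by rewrite exprn_gt0.
  move: e; case: (mu1 (W i)) => [r| |].
  - rewrite -EFinM => -[] e; congr (_%:E).
    by apply: (mulfI (lt0r_neq0 p2)); rewrite -e mulfV// lt0r_neq0.
  - by rewrite gt0_muley// lte_fin.
  - by rewrite gt0_muleNy// lte_fin.
exists (fun a => W (m - a)%N); split.
- by move=> a; have [/measurable_dyadic] := hW (m - a)%N.
- move=> a am x [Ax h]; split => // l /andP[_]; rewrite add0n => lm.
  by apply: h; rewrite add0n; apply: leq_trans lm _; apply: leq_sub2l.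
- move=> a am; rewrite muW; congr (_%:E).
  by rewrite -{2}(subnK am) exprD invfM mulrA mulrAC divff ?mul1r.
move=> a b x am bm Wx; set i := (m - a)%N in Wx.
pose j := nx (v i + m)%N; have [vj Sj] := hnx (v i + m)%N.
have bj : (b <= j)%N by rewrite (leq_trans _ vj)// (leq_trans bm)// leq_addl.
pose p := (j - b)%N.
have pv : (v i <= p)%N by rewrite /p; move: vj; rewrite -/j; lia.
have pms : (p < ms i)%N by rewrite /ms/v/= ltnS -/(v i) -/j leq_subr.
have p0 : 0 < (2 : R) ^+ p by rewrite exprn_gt0.
have x0 : 0 <= x by have [] := Wx; rewrite /A0/= in_itv/= => /andP[].
pose q := grid_index p x.
pose I : set R := `[(q%:R : R) / 2 ^+ p, q.+1%:R / 2 ^+ p[%classic.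
have dI : dyadic p I := dyadic_cell p q.
have IE y : 0 <= y -> I y -> grid_index p x = grid_index p y.
  move=> y0; rewrite /I/= in_itv/= ler_pdivrMr// ltr_pdivlMr// ![y * _]mulrC.
  by rewrite -grid_indexP// => /eqP ->.
have dW : dyadic p (W i).
  split; first by move=> u [/dA0.1].
  move=> u w w0 uw [Au hu]; split; first exact: (dyadicW (leq0n p) dA0).2 uw Au.
  move=> l li; have := hu l li; rewrite /even_digit/=.
  have lp : (ms l <= p)%N.
    apply: leq_trans pv; move: li => /andP[_];
      rewrite add0n leq_eqVlt => /orP[/eqP <-//|].
    by move=> /vmono/ltnW.
  rewrite (@grid_index_div _ (ms l) (p - ms l) u) ?(dA0.1 _ Au)//.
  by rewrite (@grid_index_div _ (ms l) (p - ms l) w)// subnKC// uw.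
have IW : I `<=` W i.
  move=> y Iy; have y0 := dI.1 _ Iy; exact: (dW.2 x y y0 (IE _ y0 Iy) Wx).
exists p, (q%:R / 2 ^+ p); split.
- by rewrite /p subnK.
- have : q == grid_index p x by [].
  rewrite eq_sym grid_indexP// => /andP[h1 h2].
  rewrite -[X in _ <= _ + X]mul1r -mulrDl ler_pdivrMr// ler_pdivlMr// !(mulrC x).
  by rewrite h1/= natr1 ltW.
have [_] := measure_even_digits (m - i) msmono pms dI.
have muI : mu1 I = ((2 ^+ p)^-1)%:E.
  rewrite lebesgue_measure_co; last by rewrite ler_pM2r ?invr_gt0// ler_nat.
  by congr (_%:E); rewrite -mulrBl -natr1 addrAC subrr add0r mul1r.
rewrite muI.
have im : (m - i)%N = a by rewrite /i subKn.
have ile : (i <= m)%N by rewrite leq_subr.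
set V := I `&` _ => hV.
have VW : V `<=` W (m - 0)%N `&` `[(q%:R / 2 ^+ p), (q%:R / 2 ^+ p + (2 ^+ p)^-1)].
  move=> y [Iy hy]; split.
    have [Ay hWy] := IW _ Iy; split => // l; rewrite add0n subn0 => /andP[_ lm].
    have [li|il] := ltnP l i; first by apply: hWy; rewrite add0n.
    by apply: hy; rewrite il im; move: lm; rewrite /i; lia.
  move: Iy; rewrite /I/= !in_itv/= => /andP[-> /ltW].
  by rewrite -natr1 mulrDl mul1r.
have mV : measurable V.
  by have [/measurable_dyadic] := measure_even_digits (m - i) msmono pms dI.
have : (mu1 V <= mu1 (W (m - 0)%N `&` `[(q%:R / 2 ^+ p)%R, (q%:R / 2 ^+ p + (2 ^+ p)^-1)%R]))%E.
  apply: le_measure => //; rewrite ?inE//; apply: measurableI;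
    last exact: measurable_itv.
  by have [/measurable_dyadic] := hW (m - 0)%N.
apply: le_trans; rewrite EFinM hV im muleA -EFinM mulVf ?mul1e//.
Qed.

End cantor_sets.

(** * Large superlevel sets rule out smaller growth *)

Section sharpness.
Context {R : realType}.
Local Notation T3 := (lebesgue_space3 R).
Local Notation mu3 := (@lebesgue_measure3 R).
Local Notation mu1 := (@lebesgue_measure R).

Lemma ln_1D_exp4 m : (0 < m)%N -> ln (1 + 4 ^+ m.+1 : R) <= 6 * m%:R.
Proof.
move=> m0; have p4 : 1 <= (4 : R) ^+ m.+1 by rewrite exprn_ege1// ler1n.
have ln2 : ln (2 : R) <= 1.
  by have := @le_ln1Dx R 1; rewrite -(natrD _ 1 1); apply; lra.
apply: (@le_trans _ _ (ln ((2 : R) ^+ (2 * m.+2)%N))).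
  rewrite ler_ln ?posrE ?exprn_gt0 ?addr_gt0 ?exprn_gt0//.
  rewrite exprM (_ : 2 ^+ 2 = 4 :> R); last by ring.
  by rewrite [leRHS]exprS; lra.
rewrite [leLHS](_ : _ = (2 * m.+2)%:R * ln 2); last by rewrite lnXn// mulr_natl.
apply: (le_trans (ler_wpM2l _ ln2)); rewrite ?mulr1//.
by rewrite -natrM ler_nat; lia.
Qed.

(** With f the indicator of E and the level 4^-(m+1), the right-hand side of a
weak type estimate is a constant times phi (4^(m+1)) |E|. *)
Definition large_superlevels k (B : set (set (R * R * R))) : Prop :=
  forall m, (0 < m)%N -> exists (E : set (R * R * R)) (e : R),
    [/\ measurable (E : set T3), 0 < e, mu3 E = e%:E &
      ((m%:R ^+ k * 4 ^+ m / 4 * e)%:E <= mu3 [set x |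
         ((4 ^+ m.+1)^-1)%:E < geometric_maximal B (\1_E : T3 -> R) x])%E].

(** An estimate would give m^k 4^m / 4 at most C phi (4^(m+1)), whereas phi
(4^(m+1)) is negligible compared with 4^(m+1) (6 m)^k. *)
Lemma no_estimate_of_large_superlevels k (B : set (set (R * R * R))) (phi : R -> R) :
  convex_increasing phi ->
  phi x / (x * ln (1 + x) ^+ k) @[x --> +oo] --> 0 ->
  large_superlevels k B -> ~ weak_type_estimate B phi.
Proof.
move=> [phi_ge0 _ _ phi0] phio hE [C hC].
have hm m : (0 < m)%N -> m%:R ^+ k * 4 ^+ m / 4 <= C * phi (4 ^+ m.+1).
  move=> m0; have [E [e [mE e0 muE le]]] := hE m m0.
  have q0 : 0 < (4 : R) ^+ m.+1 by rewrite exprn_gt0.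
  have := hC (\1_E : T3 -> R) (4 ^+ m.+1)^-1.
  have mI : measurable_fun [set: T3] (\1_E : T3 -> R) by exact: measurable_indic.
  rewrite invr_gt0 => /(_ mI q0) /(le_trans le).
  have phiE x : phi (`|\1_E x| / (4 ^+ m.+1)^-1) = phi (4 ^+ m.+1) * \1_E x.
    rewrite indicE; case: (x \in E); first by rewrite normr1 invrK mul1r mulr1.
    by rewrite normr0 mul0r phi0 mulr0.
  under eq_integral do rewrite phiE.
  rewrite (integral_scaled_indic mE muE); last by rewrite phi_ge0// ltW.
  by rewrite -!EFinM lee_fin mulrA ler_pM2r.
pose C' := Num.max C 1.
have C'0 : 0 < C' by rewrite lt_max ltr01 orbT.
have CC' : C <= C' by rewrite le_max lexx.
(* With this eps the estimate would give 1/4 <= 1/8. *)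
pose eps : R := (C' * 32 * 6 ^+ k)^-1.
have eps0 : 0 < eps by rewrite invr_gt0 !mulr_gt0// exprn_gt0.
have : \forall x \near +oo, phi x / (x * ln (1 + x) ^+ k) < eps.
  by apply: (cvgr_lt 0).
move=> [M [_ hM]]; have [m0 hm0] := ex_pow2_ge (Num.max M 1).
pose m := m0.+1.
pose x : R := 4 ^+ m.+1.
have x1 : 1 < x by rewrite exprn_egt1// ltr1n.
have xM : M < x.
  apply: (@le_lt_trans _ _ (2 ^+ m0)); first by apply: le_trans hm0;
    rewrite le_max lexx.
  apply: (@lt_trans _ _ (2 ^+ m.+1)); first by rewrite ltr_eXn2l// ltr1n.
  by rewrite ltrXn2r// ltr_nat.
have l0 : 0 < ln (1 + x) by rewrite ln_gt0// ltrDl (lt_trans _ x1).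
have x0 : 0 < x by rewrite (lt_trans _ x1).
have := hM _ xM; rewrite ltr_pdivrMr; last by rewrite mulr_gt0// exprn_gt0.
move=> h1.
have h2 : C * phi x <= C' * (eps * (x * (6 * m%:R) ^+ k)).
  apply: (@le_trans _ _ (C' * phi x)).
    by rewrite ler_wpM2r// phi_ge0// ltW.
  rewrite ler_pM2l//; apply: (le_trans (ltW h1)).
  rewrite ler_pM2l// ler_pM2l// lerXn2r ?nnegrE ?mulr_ge0//; first exact: ltW.
  exact: ln_1D_exp4.
have := le_trans (hm m isT) h2.
have -> : C' * (eps * (x * (6 * m%:R) ^+ k)) = m%:R ^+ k * 4 ^+ m / 8.
  rewrite /eps /x exprS exprMn; field.
  by rewrite !gt_eqF// exprn_gt0.
have p : 0 < m%:R ^+ k * 4 ^+ m :> R by rewrite mulr_gt0// exprn_gt0.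
set P := _ * _ in p *; lra.
Qed.

End sharpness.

(** * One shape of horizontal rectangle *)

Section lower_bounds.
Context {R : realType}.
Local Notation T3 := (lebesgue_space3 R).
Local Notation mu3 := (@lebesgue_measure3 R).
Local Notation mu1 := (@lebesgue_measure R).
Variables (S : set int) (B : set (set (R * R * R))).
Hypothesis SB : dyadic_zygmund_collection S B.

(** Every shape occurs at some place, and homothecy invariance includes
translations. *)
Lemma dyadic_zygmund_box (s t : R) (j : int) (x y z : R) : 0 < s -> 0 < t -> S j ->
  B ((`[x, x + s] `*` `[y, y + 2 ^ j * s]) `*` `[z, z + t]).
Proof.
move=> s0 t0 Sj; case: SB => hom _ /(_ s t j s0 t0 Sj)[A BA [x0 [y0 [z0 AE]]]].
have := hom A 1 (x - x0, y - y0, z - z0) BA ltr01; congr B; rewrite {}AE.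
apply/seteqP; split.
  move=> _ [[[p1 p2] p3] [[/= h1 h2] h3] <-]; rewrite scale1r.
  move: h1 h2 h3; rewrite !in_itv/= => /andP[a1 b1] /andP[a2 b2] /andP[a3 b3].
  by split; [split|]; rewrite /= ?in_itv/=; apply/andP; split; lra.
move=> [[p1 p2] p3] [[/= h1 h2] h3].
exists ((p1 - (x - x0), p2 - (y - y0)), p3 - (z - z0)); last first.
  by rewrite scale1r; congr (_, _, _) => /=; rewrite addrC subrK.
move: h1 h2 h3; rewrite !in_itv/= => /andP[a1 b1] /andP[a2 b2] /andP[a3 b3].
by split; [split|]; rewrite /= ?in_itv/=; apply/andP; split; lra.
Qed.

Lemma dyadic_zygmund_measure A : B A -> exists2 m : R, 0 < m & mu3 A = m%:E.
Proof.
case: SB => _ h _ /h[s [t [j [s0 t0 _ [x [y [z ->]]]]]]].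
have js0 : 0 < 2 ^ j * s by rewrite mulr_gt0// exp2z_gt0.
exists (s * (2 ^ j * s) * t); first by rewrite !mulr_gt0// exp2z_gt0.
by rewrite lebesgue_measure3_parallelepiped// ltW.
Qed.

(** The average of the indicator of X x Y x Z over the box is at least the
product of the densities b1, b2, b3 on its three sides. *)
Lemma dense_box_superlevel (s t : R) (j : int) (x y z u1 u2 u3 b1 b2 b3 al : R)
    (X Y Z : set R) :
  0 < s -> 0 < t -> S j -> measurable X -> measurable Y -> measurable Z ->
  x <= u1 <= x + s -> y <= u2 <= y + 2 ^ j * s -> z <= u3 <= z + t ->
  0 <= b1 -> 0 <= b2 -> 0 <= b3 -> al < b1 * b2 * b3 ->
  ((b1 * s)%:E <= mu1 (X `&` `[x, (x + s)%R]))%E ->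
  ((b2 * (2 ^ j * s))%:E <= mu1 (Y `&` `[y, (y + 2 ^ j * s)%R]))%E ->
  ((b3 * t)%:E <= mu1 (Z `&` `[z, (z + t)%R]))%E ->
  (al%:E < geometric_maximal B (\1_((X `*` Y) `*` Z) : T3 -> R) ((u1, u2), u3))%E.
Proof.
move=> s0 t0 Sj mX mY mZ hu1 hu2 hu3 b10 b20 b30 hal h1 h2 h3.
have js0 : 0 < 2 ^ j * s by rewrite mulr_gt0// exp2z_gt0.
apply/(geometric_maximal_gtP _ _ _ dyadic_zygmund_measure).
exists ((`[x, x + s] `*` `[y, y + 2 ^ j * s]) `*` `[z, z + t]).
  split; first exact: dyadic_zygmund_box.
  by split; [split|]; rewrite /= in_itv.
rewrite integral_normr_indic; last 2 first.
- by apply: measurable_box3; exact: measurable_itv.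
- exact: measurable_box3.
rewrite lebesgue_measure3_parallelepiped ?(ltW s0) ?(ltW t0) ?(ltW js0)//.
rewrite -!setXI; apply: (@lt_le_trans _ _ ((b1 * s) * (b2 * (2 ^ j * s)) * (b3 * t))%:E).
  rewrite -EFinM lte_fin.
  have -> : (b1 * s) * (b2 * (2 ^ j * s)) * (b3 * t) =
     b1 * b2 * b3 * (s * (2 ^ j * s) * t) by ring.
  by rewrite ltr_pM2r// !mulr_gt0// exp2z_gt0.
have e := lebesgue_measure3_box (measurableI _ _ mX (measurable_itv `[x, (x + s)%R]))
  (measurableI _ _ mY (measurable_itv `[y, (y + 2 ^ j * s)%R]))
  (measurableI _ _ mZ (measurable_itv `[z, (z + t)%R])).
rewrite [leRHS]e !EFinM; apply: lee_pmul => //.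
- by rewrite mule_ge0// lee_fin mulr_ge0// ltW.
- by rewrite lee_fin mulr_ge0// ltW.
- by apply: lee_pmul => //; rewrite lee_fin mulr_ge0// ltW.
Qed.

Lemma measure_pieces_le (I : finType) (P : I -> set (R * R * R)) (L : set (R * R * R)) (r : R) :
  (forall i, measurable (P i : set T3)) -> (forall i j x, P i x -> P j x -> i = j) ->
  (forall i, mu3 (P i) = r%:E) -> (forall i, P i `<=` L) ->
  ((#|I|%:R * r)%:E <= mu3 L)%E.
Proof.
move=> mP dP muP PL.
apply: (@le_trans _ _ (mu3 (\bigcup_(i in [set` [set: I]%SET]) P i)));
  last first.
  by apply: le_lebesgue_measure3 => x [i _ /PL].
rewrite (measure_finite_partition mu3 [set: I]%SET mP dP).
rewrite (eq_bigr (fun=> r%:E)); last by move=> i _; exact: muP.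
by rewrite sumEFin sumr_const cardsT mulr_natl.
Qed.

Lemma shell_inj (a b : nat) (x : R) :
  2 ^+ a < x <= 2 ^+ a.+1 -> 2 ^+ b < x <= 2 ^+ b.+1 -> a = b.
Proof.
move=> /andP[a1 a2] /andP[b1 b2].
have := lt_le_trans a1 b2; have := lt_le_trans b1 a2.
by rewrite !ltr_eXn2l ?ltr1n//; lia.
Qed.

(** These intervals are the increments of the intervals from 0 to 2^a, and
serve to make pieces of a superlevel set disjoint. *)
Definition shell (a : nat) : set R := `]2 ^+ a, 2 ^+ a.+1].

Lemma lebesgue_measure_shell a : mu1 (shell a) = (2 ^+ a)%:E.
Proof.
rewrite /shell lebesgue_measure_itv/= lte_fin ltr_eXn2l ?ltr1n// ltnSn.
by rewrite exprS; congr (_%:E); ring.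
Qed.

Lemma shell_le a u : shell a u -> 0 <= u <= 0 + 2 ^+ a.+1.
Proof.
rewrite /shell/= in_itv/= add0r => /andP[h ->]; rewrite andbT ltW//.
by apply: lt_trans h; rewrite exprn_gt0.
Qed.

Lemma lebesgue_measure_ccI (l s : R) : 0 <= l -> l <= s ->
  mu1 (`[0, l] `&` `[0, (0 + s)%R]) = l%:E.
Proof.
move=> l0 ls; rewrite (_ : _ `&` _ = `[0, l]%classic).
  by rewrite lebesgue_measure_cc// subr0.
apply/seteqP; split => x /=; rewrite !in_itv/= add0r; first by case.
by move=> /andP[-> xl]; rewrite xl (le_trans xl).
Qed.

(** The piece of index a lies in the box of sides 2^(a+1), 2^j 2^(a+1) and
2^(2(m-a)-1), in which E has the density 2^-(2m+1). It consists of the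
points whose first and third coordinates belong to the outer halves of the
sides. *)
Lemma Zygmund_large_superlevels j : S j -> large_superlevels 1 B.
Proof.
move=> Sj m m0; have J0 := @exp2z_gt0 R j.
pose E : set (R * R * R) := (`[0, 1] `*` `[0, 2 ^ j]) `*` `[0, 1].
exists E, (2 ^ j); split => //.
- by apply: measurable_box3; exact: measurable_itv.
- rewrite /E lebesgue_measure3_box// !lebesgue_measure_cc ?ltW// !subr0.
  by rewrite mul1e mule1.
pose d (a : 'I_m) := ((m - a.+1) * 2)%N.
pose P (a : 'I_m) : set (R * R * R) :=
  (shell a `*` `[0, 0 + 2 ^ j * 2 ^+ a.+1]) `*` shell (d a).
have := @measure_pieces_le _ P [set x | ((4 ^- m.+1)%:E < geometric_maximal B
   (\1_E : T3 -> R) x)%E] (2 ^ j * 4 ^+ m / 2).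
rewrite card_ord => h; apply: le_trans (h _ _ _ _).
- rewrite lee_fin expr1 -subr_ge0.
  have -> : m%:R * (2 ^ j * 4 ^+ m / 2) - m%:R * 4 ^+ m / 4 * 2 ^ j =
    m%:R * 4 ^+ m / 4 * 2 ^ j :> R by field.
  by rewrite mulr_ge0 ?(ltW J0)// divr_ge0// mulr_ge0// exprn_ge0.
- by move=> a; apply: measurable_box3; exact: measurable_itv.
- move=> a b [[x1 x2] x3] [[/= A1 _] _] [[/= B1 _] _]; apply/val_inj => /=.
  by apply: (@shell_inj a b x1); [move: A1|move: B1]; rewrite /shell/= in_itv.
- move=> a; rewrite /P lebesgue_measure3_box; [|exact: measurable_itv..].
  have p0 n : 0 < (2 : R) ^+ n by rewrite exprn_gt0.
  rewrite !lebesgue_measure_shell lebesgue_measure_cc; last first.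
    by rewrite add0r mulr_ge0// ltW.
  rewrite -!EFinM; congr (_%:E); rewrite add0r subr0.
  have -> : (4 : R) ^+ m = 2 ^+ a * 2 ^+ a.+1 * 2 ^+ (d a) * 2.
    rewrite -!exprD -exprSr (_ : 4 = 2 ^+ 2 :> R); last by ring.
    by rewrite -exprM; congr (_ ^+ _); rewrite /d; have := ltn_ord a; lia.
  by field.
- move=> a [[x1 x2] x3] [[/= A1 A2] A3].
  have p0 n : 0 < (2 : R) ^+ n by rewrite exprn_gt0.
  have p1 n : 1 <= (2 : R) ^+ n by rewrite exprn_ege1// ler1n.
  apply: (@dense_box_superlevel (2 ^+ a.+1) (2 ^+ (d a).+1) j 0 0 0 _ _ _
    (2 ^+ a.+1)^-1 (2 ^+ a.+1)^-1 (2 ^+ (d a).+1)^-1); rewrite ?invr_ge0//.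
  + exact: shell_le.
  + exact: shell_le.
  + rewrite -!invfM -!exprD ltf_pV2 ?posrE ?exprn_gt0//.
    rewrite (_ : 4 = 2 ^+ 2 :> R); last by ring.
    rewrite -exprM ltr_eXn2l ?ltr1n//.
    by rewrite /d; have := ltn_ord a; lia.
  + by rewrite lebesgue_measure_ccI// mulVf// gt_eqF.
  + rewrite lebesgue_measure_ccI ?(ltW J0)//; last by rewrite ler_peMr// ltW.
    by rewrite mulrCA mulVf ?mulr1// gt_eqF.
  + by rewrite lebesgue_measure_ccI// mulVf// gt_eqF.
Qed.

End lower_bounds.

(** * Infinitely many shapes of horizontal rectangles *)

Section infinitely_many_shapes.
Context {R : realType}.
Local Notation T3 := (lebesgue_space3 R).
Local Notation mu3 := (@lebesgue_measure3 R).
Local Notation mu1 := (@lebesgue_measure R).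
Variables (S : set int) (B : set (set (R * R * R))).
Hypothesis SB : dyadic_zygmund_collection S B.

Definition signed_int (sw : bool) (n : nat) : int := if sw then n%:Z else - n%:Z.

Lemma infinite_set_int_unbounded (A : set int) : infinite_set A ->
  exists sw, forall n, exists2 j, (n <= j)%N & A (signed_int sw j).
Proof.
move=> infA; apply: contrapT => h; apply: infA.
have hb sw : exists n, forall j, A (signed_int sw j) -> (j < n)%N.
  apply: contrapT => h'; apply: h; exists sw => n; apply: contrapT => hn.
  apply: h'; exists n => j Aj; rewrite ltnNge; apply/negP => nj.
  by apply: hn; exists j.
have [n1 h1] := hb true; have [n2 h2] := hb false.
apply: (sub_finite_set _ (finite_seq ([seq signed_int true j | j <- iota 0 n1] ++
  [seq signed_int false j | j <- iota 0 n2]))) => x Ax /=; rewrite mem_cat.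
have [xP|xN] := leP 0 x.
  have e : x = signed_int true `|x|%N by rewrite /signed_int/= gez0_abs.
  apply/orP; left; rewrite e; apply: map_f; rewrite mem_iota/= add0n h1//.
  by rewrite -e.
have e : x = signed_int false `|x|%N by rewrite /signed_int/= ltz0_abs// opprK.
apply/orP; right; rewrite e; apply: map_f; rewrite mem_iota/= add0n h2//.
by rewrite -e.
Qed.

(** The first argument X, which is to be a Cantor set, lies along the short
horizontal side. When S is unbounded above this is the first axis; when S
is unbounded below it is the second one. *)
Definition swapped_box (sw : bool) (X Y Z : set R) : set (R * R * R) :=
  if sw then (X `*` Y) `*` Z else (Y `*` X) `*` Z.

Lemma measurable_swapped_box sw (X Y Z : set R) : measurable X -> measurable Y
  -> measurable Z ->
  measurable (swapped_box sw X Y Z : set T3).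
Proof. by move=> mX mY mZ; case: sw; apply: measurable_box3. Qed.

Lemma lebesgue_measure3_swapped_box sw (X Y Z : set R) (a b c : R) :
  measurable X -> measurable Y -> measurable Z ->
  mu1 X = a%:E -> mu1 Y = b%:E -> mu1 Z = c%:E ->
  mu3 (swapped_box sw X Y Z) = (a * b * c)%:E.
Proof.
move=> mX mY mZ eX eY eZ; case: sw.
  by rewrite /swapped_box lebesgue_measure3_box// eX eY eZ -!EFinM.
by rewrite /swapped_box lebesgue_measure3_box// eX eY eZ -!EFinM (mulrC b).
Qed.

Lemma dense_swapped_box_superlevel sw (p b c : nat) (y : R) (b1 b2 b3 al : R)
    (X Y Z : set R) u :
  S (signed_int sw (p + b)%N) -> measurable X -> measurable Y -> measurable Z ->
  swapped_box sw `[y, y + (2 ^+ p)^-1] `[0, 0 + 2 ^+ b] `[0, 0 + 2 ^+ c] u ->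
  0 <= b1 -> 0 <= b2 -> 0 <= b3 -> al < b1 * b2 * b3 ->
  ((b1 * (2 ^+ p)^-1)%:E <= mu1 (X `&` `[y, (y + (2 ^+ p)^-1)%R]))%E ->
  ((b2 * 2 ^+ b)%:E <= mu1 (Y `&` `[0%R, (0 + 2 ^+ b)%R]))%E ->
  ((b3 * 2 ^+ c)%:E <= mu1 (Z `&` `[0%R, (0 + 2 ^+ c)%R]))%E ->
  (al%:E < geometric_maximal B (\1_(swapped_box sw X Y Z) : T3 -> R) u)%E.
Proof.
have p0 n : 0 < (2 : R) ^+ n by rewrite exprn_gt0.
have i0 n : 0 < ((2 : R) ^+ n)^-1 by rewrite invr_gt0.
case: u => [[u1 u2] u3] Sj mX mY mZ; case: sw Sj => /= Sj.
  have e : 2 ^ (p + b)%N * (2 ^+ p)^-1 = 2 ^+ b :> R.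
    by rewrite -exprnP exprD mulrAC divff ?mul1r// gt_eqF.
  move=> [[/= h1 h2] h3] b10 b20 b30 hal H1 H2 H3; move: h1 h2 h3;
    rewrite !in_itv/= => h1 h2 h3.
  apply: (@dense_box_superlevel _ _ _ SB (2 ^+ p)^-1 (2 ^+ c) (p + b)%N y 0 0 _
    _ _ b1 b2 b3) => //.
  - by rewrite e.
  - by rewrite e.
have e : 2 ^ (- (p + b)%N%:Z) * 2 ^+ b = (2 ^+ p)^-1 :> R.
  by rewrite -invr_expz -exprnP exprD invfM divfK// gt_eqF.
move=> [[/= h1 h2] h3] b10 b20 b30 hal H1 H2 H3; move: h1 h2 h3;
  rewrite !in_itv/= => h1 h2 h3.
apply: (@dense_box_superlevel _ _ _ SB (2 ^+ b) (2 ^+ c) _ 0 y 0 _ _ _ b2 b1 b3 _ _ _ _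
  _ _ Sj) => //.
- by rewrite e.
- by rewrite (mulrC b2).
- by rewrite e.
Qed.

(** The piece of index (a, b) consists of the points whose three coordinates
belong to X (a+1) minus X a, to the shell of index b, and to the shell of
index 2m - 2 - a - b. The three densities are 2^-(a+1), 2^-(b+1) and
2^-(2m-1-a-b), with product 2^-(2m+1), which exceeds 4^-(m+1). The measure
of a piece is that of E times 4^m / 4, and there are m^2 pieces. *)
Lemma strong_large_superlevels : infinite_set S -> large_superlevels 2 B.
Proof.
move=> /infinite_set_int_unbounded[sw unb] m m0.
have [X [mX XS muX hX]] := @cantor_sets R (fun j => S (signed_int sw j)) m unb.
have p0 n : 0 < (2 : R) ^+ n by rewrite exprn_gt0.
have p1 n : 1 <= (2 : R) ^+ n by rewrite exprn_ege1// ler1n.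
have mono a b : (a <= b)%N -> (b <= m)%N -> X a `<=` X b.
  elim: b => [|b IH]; first by rewrite leqn0 => /eqP -> _.
  rewrite leq_eqVlt => /orP[/eqP -> _ //|ab bm].
  by apply: subset_trans (XS _ bm); apply: IH (ltnW bm); rewrite -ltnS.
pose E := swapped_box sw (X 0%N) `[0, 1] `[0, 1].
pose e : R := (2 ^+ m)^-1.
exists E, e; split.
- by apply: measurable_swapped_box => //; exact: measurable_itv.
- by rewrite invr_gt0.
- rewrite (@lebesgue_measure3_swapped_box _ _ _ _ e 1 1)//.
  + by rewrite !mulr1.
  + by rewrite muX// expr0 mul1r.
  + by rewrite lebesgue_measure_cc// subr0.
  + by rewrite lebesgue_measure_cc// subr0.
pose d (i : 'I_m * 'I_m) := ((m - i.1.+1) + (m - i.2.+1))%N.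
pose P (i : 'I_m * 'I_m) : set (R * R * R) :=
  swapped_box sw (X i.1.+1 `\` X i.1) (shell i.2) (shell (d i)).
have := @measure_pieces_le R _ P [set x | ((4 ^- m.+1)%:E < geometric_maximal B
   (\1_E : T3 -> R) x)%E] (4 ^+ m / 4 * e).
rewrite card_prod !card_ord natrM -expr2 => h.
rewrite (_ : _ / 4 * e = m%:R ^+ 2 * (4 ^+ m / 4 * e)); last by rewrite !mulrA.
apply: h.
- move=> i; apply: measurable_swapped_box;
  [exact: measurableD|exact: measurable_itv..].
- move=> [a b] [a' b'] [[x1 x2] x3]; rewrite /P/=.
  have key (t t' : R) : (X a.+1 `\` X a) t -> (X a'.+1 `\` X a') t ->
      shell b t' -> shell b' t' -> (a, b) = (a', b').
    rewrite /shell/= !in_itv/= => -[Xa nXa] [Xa' nXa'] hb hb'.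
    congr (_, _); apply/val_inj => /=; last exact: shell_inj hb hb'.
    apply/eqP; rewrite eqn_leq; apply/andP; split; rewrite leqNgt;
      apply/negP => lt.
      by apply: nXa; apply: mono Xa' => //; exact: ltnW.
    by apply: nXa'; apply: mono Xa => //; exact: ltnW.
  rewrite /swapped_box; case: (sw) => -[[/= A1 A2] _] [[/= A1' A2'] _];
    first exact: key A1 A1' A2 A2'.
  exact: key A2 A2' A1 A1'.
- move=> [a b]; rewrite /P/=.
  rewrite (@lebesgue_measure3_swapped_box _ _ _ _ (2 ^+ a * e) (2 ^+ b) (2 ^+ d (a, b))).
  + congr (_%:E).
    have -> : (4 : R) ^+ m = 2 ^+ a * 2 ^+ b * 2 ^+ (d (a, b)) * 4.
      rewrite (_ : 4 = 2 ^+ 2 :> R); last by ring.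
      rewrite -!exprD -exprM; congr (_ ^+ _); rewrite /d/=.
      by have := ltn_ord a; have := ltn_ord b; lia.
    by field.
  + exact: measurableD.
  + exact: measurable_itv.
  + exact: measurable_itv.
  + have e1 := muX a.+1 (ltn_ord a); have e2 := muX a (ltnW (ltn_ord a)).
    rewrite measureD; [|exact: mX|exact: mX|by rewrite [ltLHS]e1 ltry].
    rewrite setIidr; last exact: XS.
    rewrite [X in (X - _)%E]e1 [X in (_ - X)%E]e2 -EFinB /e exprS.
    by congr (_%:E); ring.
  + exact: lebesgue_measure_shell.
  + exact: lebesgue_measure_shell.
- move=> [a b] u Pu.
  have [v [w1 [w2 [Xv vE]]]] : exists t w1 w2, X a.+1 t /\
      [/\ shell b w1, shell (d (a, b)) w2 & u = if sw then (t, w1, w2) else (w1, t, w2)].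
    move: Pu; rewrite /P/swapped_box; case: (sw);
      case: u => [[u1 u2] u3] [[/= h1 h2] h3].
      by exists u1, u2, u3; case: h1.
    by exists u2, u1, u3; case: h2.
  have [p [y [Sp hy dens]]] := hX a.+1 b.+1 v (ltn_ord a) (ltn_ord b) Xv.
  apply: (@dense_swapped_box_superlevel sw p b.+1 (d (a, b)).+1 y
    (2 ^+ a.+1)^-1 (2 ^+ b.+1)^-1 (2 ^+ (d (a, b)).+1)^-1); rewrite ?invr_ge0//.
  + case: vE => /shell_le w1b /shell_le w2b ->.
    by case: (sw); split => //=; try split; rewrite /= in_itv.
  + rewrite -!invfM -!exprD ltf_pV2 ?posrE ?exprn_gt0//.
    rewrite (_ : 4 = 2 ^+ 2 :> R); last by ring.
    rewrite -exprM ltr_eXn2l ?ltr1n//.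
    by rewrite /d/=; have := ltn_ord a; have := ltn_ord b; lia.
  + by rewrite lebesgue_measure_ccI// mulVf// gt_eqF.
  + by rewrite lebesgue_measure_ccI// mulVf// gt_eqF.
Qed.

End infinitely_many_shapes.

Unset Implicit Arguments.
Set Strict Implicit.
Set Printing Implicit Defensive.

Theorem theorem1 (R : realType) (S : set int) (B : set (set (R * R * R))) :
  S !=set0 -> dyadic_zygmund_collection S B ->
  (finite_set S ->
     weak_type_estimate B (fun u => u * (1 + logp u)) /\
     forall phi : R -> R, convex_increasing phi ->
       phi x / (x * ln (1 + x)) @[x --> +oo] --> 0 ->
       ~ weak_type_estimate B phi) /\
  (infinite_set S ->
     weak_type_estimate B (fun u => u * (1 + logp u) ^+ 2) /\
     forall phi : R -> R, convex_increasing phi ->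
       phi x / (x * ln (1 + x) ^+ 2) @[x --> +oo] --> 0 ->
       ~ weak_type_estimate B phi).
Proof.
move=> [j Sj] SB; split=> [finS|infS]; split.
- exact: weak_type_Zygmund SB finS.
- move=> phi cphi ophi; apply: (no_estimate_of_large_superlevels (k := 1) cphi ophi).
  exact: (Zygmund_large_superlevels SB Sj).
- exact: weak_type_strong SB.
- move=> phi cphi ophi; apply: (no_estimate_of_large_superlevels cphi ophi).
  exact: (strong_large_superlevels SB infS).
Qed.
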